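(* Let $q\in\mathbb{C}$, $q\neq 0$. Let $M$ be a $U(\mathfrak{h})$-free module of rank $1$ over $\mathcal{B}(q)$ (equivalently, by definition, over $\mathcal{B}'(q)$), i.e. a $\mathcal{B}'(q)$-module that is free of rank $1$ as a $U(\mathfrak{h})$-module by restriction. Then there exist $\lambda=(\lambda_1,\lambda_2)\in\mathbb{C}^2$ with $\lambda_1,\lambda_2\neq 0$ and $\alpha\in\mathbb{C}$ such that $M$ is isomorphic to $\Omega(\lambda,\alpha)$ as a $\mathcal{B}'(q)$-module.
   Context: Everything is over $\mathbb{C}$. The Block algebra $\mathcal{B}(q)$ is the Lie algebra with basis $\{L_{\mathbf{m}} : \mathbf{m}=(m_1,m_2)\in\mathbb{Z}^2\}$ and brackets $$[L_{\mathbf m},L_{\mathbf n}]=(n_1(m_2+q)-m_1(n_2+q))L_{\mathbf m+\mathbf n},\qquad \mathbf m,\mathbf n\in\mathbb{Z}^2.$$ Let $\partial_2$ be the derivation of $\mathcal{B}(q)$ with $\partial_2(L_{\mathbf m})=m_2L_{\mathbf m}$. The extended algebra is $\mathcal{B}'(q)=\mathcal{B}(q)\ltimes\mathbb{C}\partial_2$, with $[\partial_2,L_{\mathbf m}]=m_2L_{\mathbf m}$. Since $q\ne0$, put $\partial_1=q^{-1}L_{(0,0)}\in\mathcal{B}(q)$, so that $[\partial_1,L_{\mathbf m}]=m_1L_{\mathbf m}$. Put $\mathfrak{h}=\mathbb{C}\partial_1\oplus\mathbb{C}\partial_2$, an abelian subalgebra of $\mathcal{B}'(q)$, so $U(\mathfrak{h})=\mathbb{C}[\partial_1,\partial_2]$.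 A $\mathcal{B}'(q)$-module $M$ is called $U(\mathfrak{h})$-free of rank $r$ if its restriction to $U(\mathfrak{h})$ is a free module of rank $r$; in this case, by abuse of language, $M$ is also called a $U(\mathfrak{h})$-free $\mathcal{B}(q)$-module of rank $r$. For $\lambda=(\lambda_1,\lambda_2)\in\mathbb{C}^2$ with $\lambda_1\lambda_2\ne0$ and $\alpha\in\mathbb{C}$, $\Omega(\lambda,\alpha)$ is the vector space $\mathbb{C}[\partial_1,\partial_2]$ with the $\mathcal{B}'(q)$-module structure in which $\partial_1,\partial_2$ act by multiplication and $$L_{\mathbf m}\cdot f(\partial_1,\partial_2)=\lambda_1^{m_1}\lambda_2^{m_2}\bigl(\partial_1(q+m_2)-m_1(q\alpha+\partial_2)\bigr)f(\partial_1-m_1,\partial_2-m_2)$$ for $\mathbf m=(m_1,m_2)\in\mathbb{Z}^2$ and $f\in\mathbb{C}[\partial_1,\partial_2]$. *)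

(* Defs.v *)
From HB Require Import structures.
From mathcomp Require Import all_boot all_order all_algebra.
From mathcomp Require Import reals complex ring.
From mathcomp.multinomials Require Import freeg mpoly.

Set Implicit Arguments.
Unset Strict Implicit.
Unset Printing Implicit Defensive.

Import Order.TTheory GRing.Theory Num.Theory.
Local Open Scope ring_scope.

HB.mixin Record Lmodule_isLie (K : fieldType) L of GRing.Lmodule K L := {
  lie_br : L -> L -> L;
  lie_br_linearl : forall y, linear (fun x => lie_br x y);
  lie_br_linearr : forall x, linear (lie_br x);
  lie_brxx : forall x, lie_br x x = 0;
  lie_jacobi : forall x y z,
    lie_br x (lie_br y z) + lie_br y (lie_br z x) + lie_br z (lie_br x y) = 0
}.

#[short(type="lieAlgType")]
HB.structure Definition LieAlgebra (K : fieldType) :=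
  {L of GRing.Lmodule K L & Lmodule_isLie K L}.

HB.mixin Record Lmodule_isLieModule (K : fieldType) (L : lieAlgType K) V
    of GRing.Lmodule K V := {
  lie_act : L -> V -> V;
  lie_act_linearl : forall v, linear (fun x => lie_act x v);
  lie_act_linearr : forall x, linear (lie_act x);
  lie_act_br : forall x y v,
    lie_act (lie_br x y) v = lie_act x (lie_act y v) - lie_act y (lie_act x v)
}.

#[short(type="lieModType")]
HB.structure Definition LieModule (K : fieldType) (L : lieAlgType K) :=
  {V of GRing.Lmodule K V & Lmodule_isLieModule K L V}.

Definition lie_isomorphic (K : fieldType) (L : lieAlgType K)
    (M N : lieModType L) : Prop :=
  exists f : {linear M -> N},
    bijective f /\ forall (x : L) (v : M), f (lie_act x v) = lie_act x (f v).

Record derivation (K : fieldType) (L : lieAlgType K) := Derivation {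
  der_fun :> L -> L;
  der_linear : linear der_fun;
  derP : forall x y,
    der_fun (lie_br x y) = lie_br (der_fun x) y + lie_br x (der_fun y)
}.

Section LieTheory.
Context (K : fieldType) (L : lieAlgType K).
Implicit Types (x y z : L).

Lemma lie_brC x y : lie_br x y = - lie_br y x.
Proof.
have := lie_brxx (x + y).
have := lie_br_linearl (x + y) 1 x y; rewrite !scale1r => ->.
have := lie_br_linearr x 1 x y; rewrite !scale1r => ->.
have := lie_br_linearr y 1 x y; rewrite !scale1r => ->.
by rewrite !lie_brxx add0r addr0 => /eqP; rewrite addr_eq0 => /eqP.
Qed.

HB.instance Definition _ x :=
  GRing.isLinear.Build K L L _ (lie_br x) (lie_br_linearr x).

Lemma lie_brDr x y z : lie_br x (y + z) = lie_br x y + lie_br x z.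
Proof. exact: linearD. Qed.
Lemma lie_brNr x y : lie_br x (- y) = - lie_br x y.
Proof. exact: linearN. Qed.
Lemma lie_brZr a x y : lie_br x (a *: y) = a *: lie_br x y.
Proof. exact: linearZ. Qed.
Lemma lie_brDl x y z : lie_br (x + y) z = lie_br x z + lie_br y z.
Proof. by rewrite lie_brC lie_brDr opprD -!(lie_brC _ z). Qed.
Lemma lie_brZl a x y : lie_br (a *: x) y = a *: lie_br x y.
Proof. by rewrite lie_brC lie_brZr -scalerN -(lie_brC x). Qed.

Lemma lie_br0l x : lie_br 0 x = 0.
Proof. by have := lie_brZl 0 0 x; rewrite !scale0r. Qed.

HB.instance Definition _ (D : derivation L) :=
  GRing.isLinear.Build K L L _ (der_fun D) (der_linear D).

Lemma derD (D : derivation L) x y : D (x + y) = D x + D y.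
Proof. exact: linearD. Qed.
Lemma derN (D : derivation L) x : D (- x) = - D x.
Proof. exact: linearN. Qed.
Lemma derZ (D : derivation L) a x : D (a *: x) = a *: D x.
Proof. exact: linearZ. Qed.

(* [L >< K d] for a derivation [D]: the pair [(x, a)] stands for [x + a d]. *)
Definition semidirect (D : derivation L) : Type := (L * K^o)%type.
HB.instance Definition _ D :=
  GRing.Lmodule.copy (semidirect D) (L * K^o)%type.

Definition semidirect_br D (u v : semidirect D) : semidirect D :=
  (lie_br u.1 v.1 + (u.2 : K) *: D v.1 - (v.2 : K) *: D u.1, 0).

Fact semidirect_br_linearl D (v : semidirect D) :
  linear (fun u => semidirect_br u v).
Proof.
move=> a [x1 a1] [x2 a2]; case: v => y b; congr pair => /=.
  rewrite -[a *: a1]/((a : K) * a1) lie_brDl lie_brZl derD derZ.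
  rewrite !(scalerDr, scalerDl, scalerN, scalerA) (mulrC b) opprD !addrA.
  by rewrite (ACl (1*3*5*2*4*6))/=.
by rewrite scaler0 addr0.
Qed.

Fact semidirect_brC D (u v : semidirect D) :
  semidirect_br u v = - semidirect_br v u.
Proof.
congr pair => /=; last by rewrite oppr0.
by rewrite lie_brC !opprD opprK -!addrA [X in _ + X]addrC.
Qed.

Fact semidirect_br_linearr D (u : semidirect D) : linear (semidirect_br u).
Proof.
move=> a x y; rewrite semidirect_brC semidirect_br_linearl opprD -scalerN.
by rewrite -!semidirect_brC.
Qed.

Fact semidirect_brxx D (u : semidirect D) : semidirect_br u u = 0.
Proof. by congr pair => /=; rewrite lie_brxx add0r subrr. Qed.

Fact semidirect_jacobi D (u v w : semidirect D) :
  semidirect_br u (semidirect_br v w) + semidirect_br v (semidirect_br w u)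
  + semidirect_br w (semidirect_br u v) = 0.
Proof.
case: u v w => [x a] [y b] [z c]; congr pair => /=; last by rewrite !addr0.
rewrite !scale0r !subr0 !(lie_brDr, lie_brNr, lie_brZr, derD, derN, derZ) !derP.
rewrite (lie_brC (D y) z) (lie_brC (D z) x) (lie_brC (D x) y).
rewrite !(scalerDr, scalerN, scalerA) (mulrC c) (mulrC c b) (mulrC b a).
have -> : lie_br x (lie_br y z) = - lie_br y (lie_br z x) - lie_br z (lie_br x y).
  by have /eqP := lie_jacobi x y z; rewrite -addrA addr_eq0 opprD => /eqP.
rewrite !addrA.
rewrite (ACl ((1*9)*(2*16)*(3*12)*(4*20)*(5*17)*(6*11)*(7*15)*(8*21)
              *(10*19)*(13*18)*(14*22)))/=.
by rewrite !(addNr, addrN, addr0).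
Qed.

HB.instance Definition _ D := Lmodule_isLie.Build K (semidirect D)
  (@semidirect_br_linearl D) (@semidirect_br_linearr D) (@semidirect_brxx D)
  (@semidirect_jacobi D).

End LieTheory.

Section FreeModule.
Context (K : fieldType) (I : choiceType) (V : lmodType K).
Implicit Types (f g : I -> V).

Lemma freegZU (a c : K) (i : I) :
  a *: << c *g i >> = << (a * c) *g i >> :> {freeg I / K}.
Proof. by apply/eqP/freeg_eqP => j; rewrite coeffZ !coeffU mulrA. Qed.

Fact fglift_linear f : linear (fglift f : {freeg I / K} -> V).
Proof.
have addf : additive (fglift f) by exact: lift_is_additive.
move=> a x y.
have fD u v : fglift f (u + v) = fglift f u + fglift f v.
  have f0 : fglift f 0 = 0 by have := addf 0 0; rewrite !subrr.
  by have := addf u (- v); rewrite opprK => ->; have := addf 0 v;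
     rewrite !sub0r f0 sub0r => ->; rewrite opprK.
rewrite fD; congr (_ + _); rewrite -[x]freeg_sumE.
have fsum (s : seq I) (F : I -> {freeg I / K}) :
    fglift f (\sum_(i <- s) F i) = \sum_(i <- s) fglift f (F i).
  apply: (big_morph (fglift f) fD); by have := addf 0 0; rewrite !subrr.
rewrite scaler_sumr !fsum scaler_sumr; apply: eq_bigr => i _.
by rewrite freegZU !liftU scalerA.
Qed.

HB.instance Definition _ f := GRing.isLinear.Build K {freeg I / K} V _
  (fglift f) (fglift_linear f).

Lemma fglift0 f : fglift f 0 = 0 :> V.
Proof. exact: (linear0 (fglift f)). Qed.

Lemma fglift1 f i : fglift f << i >> = f i.
Proof. by rewrite liftU scale1r. Qed.

Lemma freeg_linear_ext (F G : {freeg I / K} -> V) :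
  linear F -> linear G -> (forall i, F << i >> = G << i >>) -> F =1 G.
Proof.
move=> Flin Glin FG x.
pose F' : {linear _ -> _} := HB.pack F (GRing.isLinear.Build _ _ _ _ F Flin).
pose G' : {linear _ -> _} := HB.pack G (GRing.isLinear.Build _ _ _ _ G Glin).
rewrite -[F]/(F' : _ -> _) -[G]/(G' : _ -> _) -[x]freeg_sumE !linear_sum.
apply: eq_bigr => i _; rewrite -[coeff i x]mulr1 -freegZU !linearZ.
by congr (_ *: _); apply: FG.
Qed.

End FreeModule.

(* Finitely supported functions on [Z^2]; the parameter [q] only selects the
   bracket attached to this type below. *)
Definition block (K : fieldType) (q : K) : Type := {freeg (int * int)%type / K}.

Section Block.
Context (K : fieldType) (q : K).

HB.instance Definition _ :=
  GRing.Lmodule.copy (block q) {freeg (int * int)%type / K}.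
Local Notation block := (block q).

Definition blockL (m : int * int) : block := << m >>.

Definition block_coef (m n : int * int) : K :=
  n.1%:~R * (m.2%:~R + q) - m.1%:~R * (n.2%:~R + q).

Definition block_br (x y : block) : block :=
  fglift (fun m => fglift (fun n => block_coef m n *: blockL (m + n)) y) x.

Lemma block_brL m n :
  block_br (blockL m) (blockL n) = block_coef m n *: blockL (m + n).
Proof. by rewrite /block_br !fglift1. Qed.

Fact block_br_linearl (y : block) : linear (fun x => block_br x y).
Proof. exact: fglift_linear. Qed.

Fact block_br_linearr (x : block) : linear (block_br x).
Proof.
move=> a y z; rewrite /block_br.
move: x; apply: freeg_linear_ext.
- exact: fglift_linear.
- move=> b u v; rewrite !fglift_linear !scalerDr !scalerA (mulrC b) !addrA.
  by congr (_ + _); rewrite -!addrA; congr (_ + _); rewrite addrC.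
by move=> m; rewrite !fglift1 fglift_linear.
Qed.

Fact block_brDl x y z : block_br (x + y) z = block_br x z + block_br y z.
Proof. by have := block_br_linearl z 1 x y; rewrite !scale1r. Qed.
Fact block_brDr x y z : block_br z (x + y) = block_br z x + block_br z y.
Proof. by have := block_br_linearr z 1 x y; rewrite !scale1r. Qed.
Fact block_br0 x : block_br x 0 = 0.
Proof. by apply: (addIr (block_br x 0)); rewrite -block_brDr !add0r. Qed.
Fact block_br0l x : block_br 0 x = 0.
Proof. by apply: (addIr (block_br 0 x)); rewrite -block_brDl !add0r. Qed.
Fact block_brZl a x z : block_br (a *: x) z = a *: block_br x z.
Proof. by have := block_br_linearl z a x 0; rewrite !addr0 block_br0l addr0. Qed.
Fact block_brZr a x z : block_br z (a *: x) = a *: block_br z x.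
Proof. by have := block_br_linearr z a x 0; rewrite !addr0 block_br0 addr0. Qed.
Let brE := (block_brDl, block_brDr, block_brZl, block_brZr).

Fact block_brC (x y : block) : block_br x y = - block_br y x.
Proof.
move: x; apply: freeg_linear_ext; first exact: fglift_linear.
  by move=> a u v; rewrite block_br_linearr opprD scalerN.
move=> m; move: y; apply: freeg_linear_ext; first exact: block_br_linearr.
  by move=> a u v; rewrite block_br_linearl opprD scalerN.
move=> n; rewrite !block_brL -scaleNr addrC; congr (_ *: _).
by rewrite /block_coef opprB.
Qed.

Fact block_brxx (x : block) : block_br x x = 0.
Proof.
elim/freeg_ind_dom0: x => [|c m x _ _ IH]; first exact: block_br0.
rewrite !brE IH addr0 (block_brC x) addrK.
rewrite -[c]mulr1 -freegZU !brE block_brL /block_coef subrr.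
by rewrite scale0r !scaler0.
Qed.

Fact block_jacobi (x y z : block) :
  block_br x (block_br y z) + block_br y (block_br z x)
  + block_br z (block_br x y) = 0.
Proof.
move: x; apply: freeg_linear_ext.
- move=> a u v; rewrite !brE !scalerDr !addrA.
  by rewrite (ACl (1*3*5*2*4*6))/=.
- by move=> a u v; rewrite scaler0 addr0.
move=> m; move: y; apply: freeg_linear_ext.
- move=> a u v; rewrite !brE !scalerDr !addrA.
  by rewrite (ACl (1*3*5*2*4*6))/=.
- by move=> a u v; rewrite scaler0 addr0.
move=> n; move: z; apply: freeg_linear_ext.
- move=> a u v; rewrite !brE !scalerDr !addrA.
  by rewrite (ACl (1*3*5*2*4*6))/=.
- by move=> a u v; rewrite scaler0 addr0.
move=> p; rewrite !(block_brL, brE) !scalerA.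
have -> : n + (p + m) = m + (n + p) by rewrite (addrC p) addrCA.
have -> : p + (m + n) = m + (n + p) by rewrite addrC -addrA.
rewrite -!scalerDl; apply/eqP; rewrite scaler_eq0; apply/orP; left; apply/eqP.
rewrite /block_coef /= !intrD; ring.
Qed.

HB.instance Definition _ := Lmodule_isLie.Build K block
  block_br_linearl block_br_linearr block_brxx block_jacobi.

Definition block_d2_fun (x : block) : block :=
  fglift (fun m => m.2%:~R *: blockL m) x.

Lemma block_d2L m : block_d2_fun (blockL m) = m.2%:~R *: blockL m.
Proof. exact: fglift1. Qed.

Fact block_d2_linear : linear block_d2_fun.
Proof. exact: fglift_linear. Qed.

Fact block_d2P (x y : block) : block_d2_fun (lie_br x y)
  = lie_br (block_d2_fun x) y + lie_br x (block_d2_fun y).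
Proof.
rewrite -![lie_br _ _]/(block_br _ _).
move: x; apply: freeg_linear_ext.
- by move=> a u v; rewrite !brE block_d2_linear.
- move=> a u v; rewrite block_d2_linear !brE scalerDr !addrA.
  by rewrite (ACl (1*3*2*4))/=.
move=> m; move: y; apply: freeg_linear_ext.
- by move=> a u v; rewrite !brE block_d2_linear.
- move=> a u v; rewrite block_d2_linear !brE scalerDr !addrA.
  by rewrite (ACl (1*3*2*4))/=.
move=> n; rewrite block_brL !block_d2L !brE block_brL.
rewrite -[block_coef m n *: _]addr0 block_d2_linear block_d2L.
rewrite [block_d2_fun 0](linear0 (fglift _)) !addr0 !scalerA -scalerDl.
by congr (_ *: _); rewrite /= intrD; ring.
Qed.

Definition block_d2 : derivation block := Derivation block_d2_linear block_d2P.

Definition eblock : lieAlgType K := semidirect block_d2.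

Definition ebL (m : int * int) : eblock := (blockL m, 0).
Definition ebd1 : eblock := q^-1 *: ebL 0.
Definition ebd2 : eblock := (0, 1).

Lemma ebd1_brL (m : int * int) : q != 0 ->
  lie_br ebd1 (ebL m) = m.1%:~R *: ebL m.
Proof.
move=> q0; rewrite lie_brZl; congr pair => /=; last by rewrite !scaler0.
rewrite !scale0r subr0 addr0 -[lie_br _ _]/(block_br _ _) block_brL.
by rewrite add0r scalerA; congr (_ *: _); rewrite /block_coef /=; field.
Qed.

Lemma ebd2_brL (m : int * int) : lie_br ebd2 (ebL m) = m.2%:~R *: ebL m.
Proof.
congr pair => /=; last by rewrite scaler0.
by rewrite lie_br0l scale0r subr0 add0r scale1r block_d2L.
Qed.

End Block.

(* The restriction of [M] to [U(h)]: the vector space [M], as a module over the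
   polynomial ring [K[d1, d2]]. *)
Definition Uh_restr (K : fieldType) (q : K) (M : lieModType (eblock q)) : Type :=
  M.

Section UhRestr.
Context (K : fieldType) (q : K) (M : lieModType (eblock q)).
Implicit Types (p r : {mpoly K[2]}) (v : M).

Local Notation d1 := (lie_act (ebd1 q) : M -> M).
Local Notation d2 := (lie_act (ebd2 q) : M -> M).

Definition Uh_act p v : M :=
  \sum_(m <- msupp p) p@_m *: iter (m 0) d1 (iter (m 1) d2 v).

Let X (m : 'X_{1..2}) v : M := iter (m 0) d1 (iter (m 1) d2 v).

Let d12 v : d1 (d2 v) = d2 (d1 v).
Proof.
apply/eqP; rewrite -subr_eq0 -lie_act_br.
have -> : lie_br (ebd1 q) (ebd2 q) = 0.
  by rewrite lie_brC lie_brZr ebd2_brL scale0r scaler0 oppr0.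
have /= := lie_act_linearl v 1 0 0; rewrite !scale1r addr0 => h.
by apply/eqP; apply: (addIr (lie_act 0 v)); rewrite add0r -h.
Qed.

Let X_linear m : linear (X m).
Proof.
have itl (f : M -> M) n : linear f -> linear (iter n f).
  by move=> fl a u v; elim: n => //= n ->; rewrite fl.
by move=> a u v; rewrite /X (itl _ _ (lie_act_linearr _)) (itl _ _ (lie_act_linearr _)).
Qed.

Let XD m n v : X (m + n)%MM v = X m (X n v).
Proof.
have d1it k u : d1 (iter k d2 u) = iter k d2 (d1 u).
  by elim: k => //= k IH; rewrite d12 IH.
have itC k l u : iter l d1 (iter k d2 u) = iter k d2 (iter l d1 u).
  by elim: l => //= l ->; rewrite d1it.
by rewrite /X !mnmDE !iterD -itC.
Qed.

Let Uh_actE p v : Uh_act p v = fglift (X^~ v) (mpoly_val p).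
Proof.
rewrite -[mpoly_val p]freeg_sumE (linear_sum (fglift _)) /Uh_act msuppE.
by apply: eq_bigr => m _; rewrite /= liftU.
Qed.

Let Uh_act_linearl v : linear (Uh_act^~ v).
Proof. by move=> a p r; rewrite !Uh_actE -fglift_linear. Qed.

Let Uh_act_linearr p : linear (Uh_act p).
Proof.
move=> a u v; rewrite /Uh_act scaler_sumr -big_split /=; apply: eq_bigr => m _.
by rewrite -!/(X m _) X_linear scalerDr !scalerA mulrC.
Qed.

Let Uh_actX m v : Uh_act 'X_[m] v = X m v.
Proof. by rewrite /Uh_act msuppX big_seq1 mcoeffX eqxx scale1r. Qed.

Fact Uh_actA p r v : Uh_act p (Uh_act r v) = Uh_act (p * r) v.
Proof.
have actDl u (s t : {mpoly K[2]}) : Uh_act (s + t) u = Uh_act s u + Uh_act t u.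
  by have := Uh_act_linearl u 1 s t; rewrite !scale1r.
have act0l u : Uh_act 0 u = 0 by rewrite /Uh_act msupp0 big_nil.
have actZl u b (s : {mpoly K[2]}) : Uh_act (b *: s) u = b *: Uh_act s u.
  by have := Uh_act_linearl u b s 0; rewrite !addr0 act0l addr0.
have actDr s u t : Uh_act s (u + t) = Uh_act s u + Uh_act s t.
  by have := Uh_act_linearr s 1 u t; rewrite !scale1r.
have act0r s : Uh_act s 0 = 0.
  by apply: (addIr (Uh_act s 0)); rewrite -actDr !add0r.
have actZr s b u : Uh_act s (b *: u) = b *: Uh_act s u.
  by have := Uh_act_linearr s b u 0; rewrite !addr0 act0r addr0.
rewrite [p]mpolyE mulr_suml.
rewrite !(big_morph (Uh_act^~ _) (actDl _) (act0l _)); apply: eq_bigr => m _.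
rewrite -scalerAl !actZl; congr (_ *: _).
rewrite [r]mpolyE mulr_sumr.
rewrite !(big_morph (Uh_act^~ _) (actDl _) (act0l _)).
rewrite (big_morph (Uh_act _) (actDr _) (act0r _)); apply: eq_bigr => n _.
by rewrite -scalerAr !actZl actZr -mpolyXD !Uh_actX XD.
Qed.

Fact Uh_act1 : left_id 1 Uh_act.
Proof. by move=> v; rewrite -mpolyX0 Uh_actX /X !mnm0E. Qed.

Fact Uh_actDr : right_distributive Uh_act +%R.
Proof. by move=> p u v; have := Uh_act_linearr p 1 u v; rewrite !scale1r. Qed.

Fact Uh_actDl v : {morph Uh_act^~ v : p r / p + r}.
Proof. by move=> p r; have := Uh_act_linearl v 1 p r; rewrite !scale1r. Qed.

HB.instance Definition _ := GRing.Zmodule.copy (Uh_restr M) M.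
HB.instance Definition _ := GRing.Zmodule_isLmodule.Build {mpoly K[2]} (Uh_restr M)
  Uh_actA Uh_act1 Uh_actDr Uh_actDl.

Lemma Uh_restr_X0 (v : Uh_restr M) : 'X_0 *: v = lie_act (ebd1 q) v.
Proof. by rewrite [LHS]Uh_actX /X !mnm1E. Qed.

Lemma Uh_restr_X1 (v : Uh_restr M) : 'X_1 *: v = lie_act (ebd2 q) v.
Proof. by rewrite [LHS]Uh_actX /X !mnm1E. Qed.

Lemma Uh_restr_C (c : K) (v : Uh_restr M) : c%:MP *: v = c *: (v : M).
Proof.
have := Uh_act_linearl v c 1 0; rewrite !addr0 Uh_act1 -mul_mpolyC mulr1 => h.
by rewrite [LHS]h /Uh_act msupp0 big_nil addr0.
Qed.

End UhRestr.

Definition free_of_rank (A : comNzRingType) (V : lmodType A) (r : nat) : Prop :=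
  exists w : 'I_r -> V, forall v : V,
    exists! c : {ffun 'I_r -> A}, v = \sum_(i < r) c i *: w i.

Definition Uh_free_of_rank (K : fieldType) (q : K) (M : lieModType (eblock q))
    (r : nat) : Prop :=
  free_of_rank (Uh_restr M) r.

(* As for [block], the parameters only select the action defined below. *)
Definition Omega (K : fieldType) (q l1 l2 a : K)
  (l1_neq0 : l1 != 0) (l2_neq0 : l2 != 0) : Type := {mpoly K[2]}.

Section Omega.
Context (K : fieldType) (q l1 l2 a : K) (l1_neq0 : l1 != 0) (l2_neq0 : l2 != 0).

Local Notation P := {mpoly K[2]}.

Local Notation Omega := (Omega q a l1_neq0 l2_neq0).
HB.instance Definition _ := GRing.Lmodule.copy Omega {mpoly K[2]}.

Definition shift_poly (m : int * int) (f : P) : P :=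
  f \mPo [tuple 'X_0 - m.1%:~R; 'X_1 - m.2%:~R].

Definition Omega_actL (m : int * int) (f : P) : P :=
  (l1 ^ m.1 * l2 ^ m.2) *:
  (('X_0 * (q%:MP + m.2%:~R) - m.1%:~R * ((q * a)%:MP + 'X_1)) * shift_poly m f).

Definition Omega_act (u : eblock q) (f : Omega) : Omega :=
  fglift (Omega_actL^~ f) u.1 + (u.2 : K) *: ('X_1 * f).

Fact shift_poly_linear m : linear (shift_poly m).
Proof. by move=> c f g; rewrite /shift_poly linearP. Qed.

Fact shift_polyM m (f g : P) :
  shift_poly m (f * g) = shift_poly m f * shift_poly m g.
Proof. exact: rmorphM. Qed.

Fact shift_polyX0 m : shift_poly m 'X_0 = 'X_0 - m.1%:~R.
Proof. exact: comp_mpolyXU. Qed.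
Fact shift_polyX1 m : shift_poly m 'X_1 = 'X_1 - m.2%:~R.
Proof. exact: comp_mpolyXU. Qed.

Fact shift_polyD m n (f : P) :
  shift_poly m (shift_poly n f) = shift_poly (m + n) f.
Proof.
rewrite /shift_poly !(comp_mpolyEX f) (linear_sum (comp_mpoly _)) /=.
apply: eq_bigr => k _; rewrite comp_mpolyZ; congr (_ *: _).
rewrite !comp_mpolyX !big_ord_recl !big_ord0 !mulr1.
rewrite rmorphM !rmorphXn !(tnth_nth 0) /= !rmorphB /= !rmorph_int.
rewrite [X in X ^+ _ * _](_ : _ = 'X_0 - (m.1 + n.1)%:~R); last first.
  by rewrite comp_mpolyXU /= intrD opprD addrA.
rewrite [X in _ * X ^+ _](_ : _ = 'X_1 - (m.2 + n.2)%:~R) //.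
by rewrite comp_mpolyXU /= intrD opprD addrA.
Qed.

Fact Omega_actL_linear m : linear (Omega_actL m).
Proof.
move=> c f g; rewrite /Omega_actL shift_poly_linear mulrDr -scalerAr scalerDr.
by rewrite !scalerA mulrC.
Qed.

Fact Omega_actL_br m n (f : P) :
  block_coef q m n *: Omega_actL (m + n) f =
  Omega_actL m (Omega_actL n f) - Omega_actL n (Omega_actL m f).
Proof.
have shiftZ k c g : shift_poly k (c *: g) = c *: shift_poly k g.
  exact: comp_mpolyZ.
rewrite {2 4}/Omega_actL /Omega_actL !shiftZ !shift_polyM !shift_polyD (addrC n m).
have shiftE k l : shift_poly k
    ('X_0 * (q%:MP + l.2%:~R) - l.1%:~R * ((q * a)%:MP + 'X_1)) =
    ('X_0 - k.1%:~R) * (q%:MP + l.2%:~R)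
      - l.1%:~R * ((q * a)%:MP + ('X_1 - k.2%:~R)).
  rewrite -shift_polyX0 -shift_polyX1 /shift_poly.
  by rewrite !(rmorphB, rmorphM, rmorphD) /= !rmorph_int !comp_mpolyC.
rewrite !shiftE !expfzDr //= -!mul_mpolyC /block_coef.
rewrite !(mpolyCM, mpolyCB, mpolyCD) !intrD !rmorph_int.
ring.
Qed.

Fact Omega_act_linearl (f : Omega) : linear (fun u => Omega_act u f).
Proof.
move=> c u v; rewrite /Omega_act fglift_linear.
rewrite -[(c *: u + v).2]/((c : K) * u.2 + v.2) scalerDl scalerDr scalerA !addrA.
by rewrite (ACl (1*3*2*4)).
Qed.

Let A (x : block q) (f : P) : P := fglift (Omega_actL^~ f) x.

Let A_linearl f : linear (A^~ f). Proof. exact: fglift_linear. Qed.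

Let AL m f : A (blockL q m) f = Omega_actL m f. Proof. exact: fglift1. Qed.

Let A_linearr x : linear (A x).
Proof.
move=> c f g; move: x; apply: freeg_linear_ext; first exact: A_linearl.
  move=> b u v; rewrite !A_linearl !scalerDr !scalerA (mulrC b) !addrA.
  by rewrite (ACl (1*3*2*4)).
by move=> m; rewrite !AL Omega_actL_linear.
Qed.

Let ADr x f g : A x (f + g) = A x f + A x g.
Proof. by have := A_linearr x 1 f g; rewrite !scale1r. Qed.
Let ADl x y f : A (x + y) f = A x f + A y f.
Proof. by have := A_linearl f 1 x y; rewrite !scale1r. Qed.
Let A0l f : A 0 f = 0.
Proof. by apply: (addIr (A 0 f)); rewrite -ADl !add0r. Qed.
Let A0r x : A x 0 = 0.
Proof. by apply: (addIr (A x 0)); rewrite -ADr !add0r. Qed.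
Let AZl c x f : A (c *: x) f = c *: A x f.
Proof. by have := A_linearl f c x 0; rewrite !addr0 A0l addr0. Qed.
Let AZr c x f : A x (c *: f) = c *: A x f.
Proof. by have := A_linearr x c f 0; rewrite !addr0 A0r addr0. Qed.
Let ANl x f : A (- x) f = - A x f.
Proof. by rewrite -scaleN1r AZl scaleN1r. Qed.

Let A_br x y f : A (block_br x y) f = A x (A y f) - A y (A x f).
Proof.
move: x; apply: freeg_linear_ext.
- by move=> c u v; rewrite block_br_linearl A_linearl.
- move=> c u v; rewrite !A_linearl A_linearr scalerBr opprD !addrA.
  by rewrite (ACl (1*3*2*4)).
move=> m; move: y; apply: freeg_linear_ext.
- by move=> c u v; rewrite block_br_linearr A_linearl.
- move=> c u v; rewrite !A_linearl A_linearr scalerBr opprD !addrA.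
  by rewrite (ACl (1*3*2*4)).
by move=> n; rewrite block_brL AZl !AL Omega_actL_br.
Qed.

Let A_d2 x f : A (block_d2 q x) f = 'X_1 * A x f - A x ('X_1 * f).
Proof.
move: x; apply: freeg_linear_ext.
- by move=> c u v; rewrite der_linear A_linearl.
- move=> c u v; rewrite !A_linearl mulrDr -scalerAr scalerBr opprD !addrA.
  by rewrite (ACl (1*3*2*4)).
move=> m; rewrite [block_d2 q _]block_d2L AZl !AL /Omega_actL shift_polyM.
rewrite shift_polyX1 -!mul_mpolyC rmorph_int; ring.
Qed.

Fact Omega_act_linearr (u : eblock q) : linear (Omega_act u).
Proof.
move=> c f g; rewrite /Omega_act -![fglift _ _]/(A _ _) A_linearr.
rewrite mulrDr -scalerAr !scalerDr scalerA mulrC -scalerA !addrA.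
by rewrite (ACl (1*3*2*4)).
Qed.

Fact Omega_act_br (u v : eblock q) (f : Omega) :
  Omega_act (lie_br u v) f =
  Omega_act u (Omega_act v f) - Omega_act v (Omega_act u f).
Proof.
case: u v => [x b] [y c].
rewrite /Omega_act -![fglift _ _]/(A _ _) /= scale0r addr0.
rewrite !ADl ANl !AZl !ADr !AZr !A_d2 A_br.
rewrite !mulrDr -!scalerAr !scalerBr !scalerDr !scalerA (mulrC c) !opprD !opprK.
by rewrite !addrA [in RHS](ACl (1*5*3*6*7*2*(4*8)))/= addrN addr0.
Qed.

HB.instance Definition _ := Lmodule_isLieModule.Build K (eblock q) Omega
  Omega_act_linearl Omega_act_linearr Omega_act_br.

Lemma Omega_L m (f : Omega) : lie_act (ebL q m) f = Omega_actL m f.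
Proof.
by rewrite -[lie_act _ _]/(Omega_act _ _) /Omega_act /= scale0r addr0 fglift1.
Qed.

Lemma Omega_d1 (f : Omega) : q != 0 -> lie_act (ebd1 q) f = 'X_0 * f.
Proof.
move=> q0; have := Omega_act_linearl f q^-1 (ebL q 0) 0.
rewrite addr0 -[Omega_act _ _]/(lie_act (ebd1 q) f) => ->.
rewrite [Omega_act 0 f]/Omega_act /= fglift0 scale0r !addr0.
rewrite -[Omega_act _ _]/(lie_act (ebL q 0) f) Omega_L /Omega_actL /=.
have -> : shift_poly 0 f = f.
  rewrite /shift_poly -[RHS]comp_mpoly_id; congr (comp_mpoly _ f).
  apply: eq_from_tnth => i; rewrite tnth_mktuple (tnth_nth 0) /=.
  case: i => [[|[|]]] //= ?; rewrite subr0; congr ('X_ _); exact: val_inj.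
rewrite !expr0z mulr1 scale1r mul0r subr0 addr0 (mulrC 'X_0) -mulrA.
by rewrite mul_mpolyC scalerA mulVf // scale1r.
Qed.

Lemma Omega_d2 (f : Omega) : lie_act (ebd2 q) f = 'X_1 * f.
Proof.
by rewrite -[lie_act _ _]/(Omega_act _ _) /Omega_act /= scale1r fglift0 add0r.
Qed.

End Omega.

(* Main.v *)
From HB Require Import structures.
Require Import Defs.
From mathcomp Require Import all_boot all_order all_algebra.
From mathcomp Require Import reals complex ring zify.
From mathcomp.multinomials Require Import freeg mpoly.

(** Fix a generator w of the module and write L_m w = g_m w with g_m in K[x, y],
    where x and y stand for d_1 and d_2. Since L_m translates the variables by m
    when it moves past them (L_semilinear), the g_m determine the module, and the
    bracket relations become
      g_m(X) g_n(X - m) - g_n(X) g_m(X - n) = c(m, n) g_(m+n)(X),   g_0 = q x,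
    where c(m, n) is the structure constant of the Block algebra. It remains to
    show that the only solutions of these equations are those of Omega.

    The proof looks at the degree in y. The vertical elements L_(0,k) and L_(0,-k)
    commute, so g_(0,k) g_(0,-k)(x, y - k) is invariant under a translation of y,
    and each g_(0,k) depends on x only (G_vert_poly). Moving along a column by
    L_(0,k) and back by L_(0,-k) compares the leading coefficients in y, which shows
    that g_(0,k) is affine in x (G_vert_affine), and also yields a second order
    difference equation in y for g_n which forces g_n to have degree one in y when
    n_1 is nonzero (size_G_horiz). This needs k to be different from 0, q and -q;
    there are always two consecutive such integers.

    At this point [L_(1,0), L_(-1,0)] = -2 q L_0 makes g_(1,0) and g_(-1,0) affine
    in both variables (G_pm1_affine), and the brackets of L_(1,k) with L_(-1,0) for
    two values of k leave only the parameters lambda_1 and alpha free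
    (G_generators). Moving along the columns introduces lambda_2 (G_columns), and
    brackets give the remaining g_m (G_classification). *)

Set Implicit Arguments.
Unset Strict Implicit.
Unset Printing Implicit Defensive.

Import Order.TTheory GRing.Theory Num.Theory.
Local Open Scope ring_scope.

(** * Translations of polynomials in one variable *)

Section Shift.
Context (A : idomainType) (A0 : forall n, n.+1%:R != 0 :> A).
Implicit Types (p : {poly A}) (c : A).

(** A translation leaves the leading coefficient alone and changes the next one
    by a multiple of it that is nonzero in characteristic zero: this bounds the
    degree of polynomials that satisfy difference equations. *)
Lemma coef_shift p c n : (size p <= n.+2)%N ->
  (p \Po ('X - c%:P))`_n = p`_n - c * p`_n.+1 *+ n.+1.
Proof.
elim: n p => [|n IH] p; elim/poly_ind: p => [|p d _].
- by rewrite comp_poly0 !coef0 mulr0 mul0rn subr0.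
- have [->|p0] := eqVneq p 0.
    by rewrite mul0r add0r comp_polyC !coefC /= mulr0 subr0.
  rewrite -cons_poly_def size_cons_poly nil_poly (negbTE p0) /= => sp.
  have /size1_polyC -> : (size p <= 1)%N by [].
  rewrite cons_poly_def comp_poly_MXaddC comp_polyC.
  rewrite coefD coefCM coefC coefB coefX !coefC /=.
  by rewrite !coefD !coefMX !coefC /= ; ring.
- by rewrite comp_poly0 !coef0 mulr0 mul0rn subr0.
- have [->|p0] := eqVneq p 0.
    by rewrite mul0r add0r comp_polyC !coefC /= mulr0 mul0rn subr0.
  rewrite -cons_poly_def size_cons_poly nil_poly (negbTE p0) /= => sp.
  have E1 := IH p sp.
  rewrite cons_poly_def comp_poly_MXaddC mulrBr.
  rewrite coefD coefB coefMX coefMC coefC /= E1 !coefD !coefMX !coefC /= !addr0.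
  (* The index n.+1 is at least the degree of p, so the translation does not change
     the coefficient there. *)
  suff -> : (p \Po ('X - c%:P))`_n.+1 = p`_n.+1.
    by rewrite [in RHS]mulrSr opprD addrA (mulrC c).
  have sz : size (p \Po ('X - c%:P)) = size p by rewrite size_comp_poly2 ?size_XsubC.
  have [sp2|] := leqP (size p) n.+1.
    by rewrite !nth_default ?sz.
  move=> sp3; have {sp3 sp}sp : size p = n.+2.
    by apply/eqP; rewrite eqn_leq; apply/andP; split.
  have := lead_coef_comp p (q := 'X - c%:P).
  rewrite size_XsubC lead_coefXsubC expr1n mulr1 => /(_ isT).
  by rewrite !lead_coefE sz sp.
Qed.

Lemma shift_invariant_size p c : c != 0 -> p \Po ('X - c%:P) = p ->
  (size p <= 1)%N.
Proof.
move=> c0 h; rewrite leqNgt; apply/negP.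
case E : (size p) => [|[|n]] // _.
have := coef_shift c (eq_leq E); rewrite h => /eqP.
rewrite eq_sym subr_eq -subr_eq0 opprD addNKr oppr_eq0.
rewrite -mulr_natr !mulf_eq0 (negbTE c0) (negbTE (A0 _)) orbF /=.
have -> : p`_n.+1 = lead_coef p by rewrite lead_coefE E.
by rewrite lead_coef_eq0 -size_poly_eq0 E.
Qed.

Lemma shift_diff_size p c : c != 0 -> (size (p \Po ('X - c%:P) - p)%R <= 1)%N ->
  (size p <= 2)%N.
Proof.
move=> c0 h; rewrite leqNgt; apply/negP.
case E : (size p) => [|[|[|n]]] // _.
have : (p \Po ('X - c%:P) - p)`_n.+1 == 0 by rewrite nth_default // (leq_trans h).
rewrite coefB coef_shift ?E // addrC addKr oppr_eq0 -mulr_natr.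
rewrite !mulf_eq0 (negbTE c0) (negbTE (A0 _)) orbF /=.
have -> : p`_n.+2 = lead_coef p by rewrite lead_coefE E.
by rewrite lead_coef_eq0 -size_poly_eq0 E.
Qed.

Lemma poly_eval_inj p r : (forall n : nat, p.[n%:R] = r.[n%:R]) -> p = r.
Proof.
move=> h; apply/eqP; rewrite -subr_eq0; apply/eqP.
apply: (@roots_geq_poly_eq0 _ _ [seq i%:R | i <- iota 0 (size (p - r))]).
- by apply/allP => _ /mapP[i _ ->]; rewrite rootE hornerD hornerN h subrr.
- rewrite map_inj_uniq ?iota_uniq // => i j.
  wlog: i j / (i <= j)%N => [w|ij].
    by have [ij|/ltnW ji] := leqP i j; [exact: w|move=> /esym /(w _ _ ji) ->].
  move=> /eqP; rewrite eq_sym -subr_eq0 -natrB //.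
  have := subnKC ij; case: (j - i)%N => [|d] <-; first by rewrite addn0.
  by rewrite (negbTE (A0 _)).
- by rewrite size_map size_iota.
Qed.

End Shift.

(** * Polynomials in two variables and their values *)

Section Eval.
Context (K : numFieldType).
Implicit Types (P Q : {poly {poly K}}) (x y : K).

Lemma natS_neq0 n : n.+1%:R != 0 :> K.
Proof. by rewrite pnatr_eq0. Qed.

Lemma natS_poly_neq0 n : n.+1%:R != 0 :> {poly K}.
Proof. by rewrite -(rmorph_nat (@polyC K)) polyC_eq0 natS_neq0. Qed.

(** Polynomials in x and y are encoded as polynomials in y over K[x]: the proof
    looks at the degree in y, then at the coefficients as polynomials in x. *)
Definition ev P x y : K := P.[y%:P].[x].

Lemma ev_inj P Q : (forall x y, ev P x y = ev Q x y) -> P = Q.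
Proof.
move=> h; apply: (poly_eval_inj natS_poly_neq0) => n.
apply: (poly_eval_inj natS_neq0) => l.
by rewrite -(rmorph_nat (@polyC K)); apply: h.
Qed.

Lemma evM P Q x y : ev (P * Q) x y = ev P x y * ev Q x y.
Proof. by rewrite /ev !hornerM. Qed.
Lemma evD P Q x y : ev (P + Q) x y = ev P x y + ev Q x y.
Proof. by rewrite /ev !hornerD. Qed.
Lemma evN P x y : ev (- P) x y = - ev P x y.
Proof. by rewrite /ev !hornerN. Qed.
Lemma evC (p : {poly K}) x y : ev p%:P x y = p.[x].
Proof. by rewrite /ev hornerC. Qed.

Definition evE := (evM, evD, evN, evC).

Lemma ev_size2 P x y : (size P <= 2)%N -> ev P x y = (P`_1).[x] * y + (P`_0).[x].
Proof.
move=> sP; rewrite /ev (horner_coef_wide _ sP) !big_ord_recl big_ord0 /= addr0.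
by rewrite expr0 expr1 mulr1 hornerD hornerM hornerC addrC.
Qed.

Lemma horner_size2 (p : {poly K}) x : (size p <= 2)%N -> p.[x] = p`_1 * x + p`_0.
Proof.
move=> sp; rewrite (horner_coef_wide _ sp) !big_ord_recl big_ord0 /= addr0.
by rewrite expr0 expr1 mulr1 addrC.
Qed.

Definition yshift (c : K) P := P \Po ('X - c%:P%:P).

Lemma ev_yshift c P x y : ev (yshift c P) x y = ev P x (y - c).
Proof. by rewrite /ev horner_comp hornerD hornerN hornerX hornerC -polyCB. Qed.

Definition xshift (c : K) (p : {poly K}) := p \Po ('X - c%:P).

Lemma horner_xshift c p x : (xshift c p).[x] = p.[x - c].
Proof. by rewrite horner_comp hornerD hornerN hornerX hornerC. Qed.

Lemma size_xshift c p : size (xshift c p) = size p.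
Proof. by rewrite size_comp_poly2 ?size_XsubC. Qed.

Lemma xshift_invariant_const c p : c != 0 ->
  (forall x, p.[x - c] = p.[x]) -> exists w, p = w%:P.
Proof.
move=> c0 h; exists p`_0; apply: size1_polyC.
apply: (shift_invariant_size (@natS_neq0) c0); rewrite -/(xshift c p).
by apply: (poly_eval_inj natS_neq0) => n; rewrite horner_xshift.
Qed.

Lemma affine_neq0 (r s : K) : r != 0 -> r *: 'X + s%:P != 0.
Proof.
move=> r0; apply/eqP => /(congr1 (fun p : {poly K} => p`_1)).
by rewrite coefD coefZ coefX coefC /= mulr1 addr0 coef0 => /eqP; rewrite (negbTE r0).
Qed.

Lemma xshift_diff_affine (p : {poly K}) : size (p - xshift 1 p) = 1%N ->
  exists r s, p = r *: 'X + s%:P /\ p - xshift 1 p = r%:P.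
Proof.
move=> s1; have s2 : (size p <= 2)%N.
  apply: (@shift_diff_size _ natS_neq0 p 1 (oner_neq0 _)).
  by rewrite -opprB size_polyN s1.
have -> : p = p`_1 *: 'X + (p`_0)%:P.
  apply/polyP => i; rewrite coefD coefZ coefX coefC.
  case: i => [|[|i]] /=; rewrite ?mulr0 ?mulr1 ?add0r ?addr0 //.
  by rewrite nth_default // (leq_trans s2).
exists p`_1, p`_0; split => //.
rewrite /xshift comp_polyD comp_polyZ comp_polyX comp_polyC -!mul_polyC.
by rewrite polyC1; ring.
Qed.

Lemma mul_const_size1 (p r : {poly K}) (c : K) :
  c != 0 -> p * r = c%:P -> size p = 1%N /\ size r = 1%N.
Proof.
move=> c0 pr; have /andP[p0 r0] : (p != 0) && (r != 0).
  by rewrite -negb_or -mulf_eq0 pr polyC_eq0.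
have := size_mul p0 r0; rewrite pr size_polyC c0.
move: p0 r0; rewrite -!size_poly_eq0.
by case: (size p) (size r) => [|[|i]] [|[|j]] //=; rewrite ?addnS.
Qed.

Lemma quadratic_coefs (a b c : K) :
  (forall y, a * y ^+ 2 + b * y + c = 0) -> [/\ a = 0, b = 0 & c = 0].
Proof.
move=> h; have c0 : c = 0 by rewrite -(h 0); ring.
have e1 := h 1; have e2 := h (-1).
have two : 2%:R != 0 :> K by rewrite pnatr_eq0.
have a0 : a = 0.
  apply: (mulfI two); rewrite mulr0 -[RHS](addr0 0) -{1}e1 -e2 c0; ring.
by split=> //; rewrite -e1 a0 c0; ring.
Qed.

Lemma size_yshift c P : size (yshift c P) = size P.
Proof. by rewrite size_comp_poly2 ?size_XsubC. Qed.

End Eval.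

(** * The bracket relation and the vertical elements *)

Section Core.
Context (K : numFieldType) (q : K) (q0 : q != 0).
Context (G : int * int -> {poly {poly K}}).
Context (G_br : forall m n x y,
  ev (G m) x y * ev (G n) (x - m.1%:~R) (y - m.2%:~R)
  - ev (G n) x y * ev (G m) (x - n.1%:~R) (y - n.2%:~R)
  = block_coef q m n * ev (G (m + n)) x y).
Context (G_0 : forall x y, ev (G 0) x y = q * x).
Implicit Types (m n : int * int) (k l : int) (x y : K).

(** The factor by which L_m acts on the generator of Omega(lambda, alpha), up to
    the character lambda^m. *)
Definition weight a m x y : K :=
  x * (q + m.2%:~R) - m.1%:~R * (q * a + y).

(** For these k the vertical element L_(0,k) moves L_n to a nonzero multiple of
    L_(n + (0,k)) whenever n_1 is nonzero, and so does L_(0,-k) backwards; the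
    case k = 0 is left out because it moves nothing. *)
Definition regular k := (k != 0) && (k%:~R ^+ 2 != q ^+ 2).

Lemma regularP k : regular k ->
  [/\ k%:~R != 0 :> K, k%:~R + q != 0 & q - k%:~R != 0].
Proof.
case/andP=> k0; rewrite eq_sym -subr_eq0 subr_sqr mulf_eq0 negb_or.
by case/andP=> ? ?; split; rewrite ?intr_eq0 // addrC.
Qed.

Lemma regularN k : regular (- k) = regular k.
Proof. by rewrite /regular oppr_eq0 rmorphN sqrrN. Qed.

(** A step up by one of two consecutive regular integers and down by the other moves
    by one place; the pair also gives two instances of each relation in k. *)
Lemma regular_consecutive : exists2 j, regular j & regular (j + 1).
Proof.
have sq (a b : nat) : (a ^ 2 != b ^ 2)%N -> (a%:~R ^+ 2 != b%:~R ^+ 2 :> K).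
  by rewrite -!pmulrn -!natrX eqr_nat.
(* The pair is (1, 2), unless q is one of 1, -1, 2, -2; then it is (3, 4). *)
have [h1|h1] := boolP (regular 1); last first.
  exists 3; move: h1; rewrite /regular /= negbK => /eqP <-; exact: sq.
have [h2|h2] := boolP (regular 2); first by exists 1.
exists 3; move: h2; rewrite /regular /= negbK => /eqP <-; exact: sq.
Qed.

Lemma vert_add k n : (0, k) + n = (n.1, n.2 + k).
Proof. by case: n => a b; rewrite -[LHS]/(0 + a, k + b) add0r addrC. Qed.

Lemma pm1_add k : (1, k) + (-1, 0) = (0, k) :> (int * int)%type.
Proof. exact: (congr1 (pair 0) (addr0 k)). Qed.

(** If L_n acts by zero then so does [L_n, L_-n], a nonzero multiple of L_0. *)
Lemma G_neq0 n : n.1 != 0 -> G n != 0.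
Proof.
move=> n0; apply/eqP => Gn.
have := G_br n (- n) 1 0; rewrite subrr G_0 Gn /ev !horner0 mul0r mulr0 subrr.
move=> /esym/eqP; rewrite /block_coef /= !rmorphN /=.
have -> : forall a b : K, - a * (b + q) - a * (- b + q) = - (2%:R * q * a).
  by move=> a b; ring.
by rewrite mulr1 mulf_eq0 oppr_eq0 !mulf_eq0 (negbTE q0) pnatr_eq0 intr_eq0 (negbTE n0).
Qed.

Lemma G_neq0_vert k : regular k -> G (0, k) != 0.
Proof.
case/regularP => _ k0 _; apply/eqP => Gk.
suff : G (1, k) = 0 by apply/eqP/G_neq0.
apply: ev_inj => x y; have := G_br (0, k) (1, 0) x y.
rewrite vert_add /= add0r.
rewrite Gk /ev !horner0 mul0r mulr0 subrr /block_coef /= mul1r mul0r subr0.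
by move=> /esym/eqP; rewrite mulf_eq0 (negbTE k0) => /eqP.
Qed.

(** The elements L_(0,k) and L_(0,-k) commute, which makes the product of one
    polynomial with the y-translate of the other invariant under y-translation.
    Being nonzero, this product has degree 0 in y, hence so do both factors. *)
Lemma G_vert_poly k : regular k -> exists p, G (0, k) = p%:P.
Proof.
move=> kg; have [k0 _ _] := regularP kg.
pose h := G (0, k) * yshift k%:~R (G (0, - k)).
have hinv : yshift k%:~R h = h.
  apply: ev_inj => x y; rewrite ev_yshift !evM !ev_yshift.
  have := G_br (0, k) (0, - k) x (y - k%:~R).
  rewrite /block_coef /= !mul0r subrr !mul0r !subr0 rmorphN /= opprK subrK.
  by move=> /eqP; rewrite subr_eq0 => /eqP -> ; rewrite mulrC.
have h1 : (size h <= 1)%N.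
  by apply: (shift_invariant_size (natS_poly_neq0 K) _ hinv); rewrite polyC_eq0.
exists (G (0, k))`_0; apply: size1_polyC; apply: leq_trans h1.
have h0 := G_neq0_vert kg; have h0' : G (0, - k) != 0 by rewrite G_neq0_vert ?regularN.
rewrite size_mul -?size_poly_eq0 ?size_yshift ?size_poly_eq0 //.
by rewrite -subn1 leq_subRL addnC ?leq_add2l lt0n ?addn_eq0 size_poly_eq0 (negbTE h0').
Qed.

(** The bracket of a vertical element with L_n, once the action of the vertical
    element is known to be free of y. *)
Lemma G_vert_step k p n : G (0, k) = p%:P ->
  p%:P * yshift k%:~R (G n) - G n * (xshift n.1%:~R p)%:P =
  (n.1%:~R * (k%:~R + q))%:P%:P * G (n.1, n.2 + k).
Proof.
move=> Gk; apply: ev_inj => x y; rewrite !evE ev_yshift horner_xshift hornerC.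
have := G_br (0, k) n x y; rewrite Gk !evC /= subr0 => ->.
by rewrite vert_add /block_coef /= mul0r subr0.
Qed.

(** Comparison of the coefficients of y^d in the previous identity, where d bounds
    the degree: translating y does not affect the top coefficient. *)
Lemma G_vert_top k p n d : G (0, k) = p%:P -> (size (G n) <= d.+1)%N ->
  (p - xshift n.1%:~R p) * (G n)`_d =
  (n.1%:~R * (k%:~R + q))%:P * (G (n.1, n.2 + k)%R)`_d.
Proof.
move=> Gk sd; have := congr1 (fun P : {poly {poly K}} => P`_d) (G_vert_step n Gk).
rewrite coefB !coefCM coefMC mulrBl (mulrC (xshift _ _)) => <-; congr (_ * _ - _).
rewrite /yshift coef_shift; last exact: leq_trans sd _.
by rewrite [_`_d.+1]nth_default // mulr0 mul0rn subr0.
Qed.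

Lemma size_G_vert k n : n.1 != 0 -> regular k ->
  (size (G (n.1, n.2 + k)%R) <= size (G n))%N.
Proof.
move=> n0 kg; have [p Gk] := G_vert_poly kg; have [_ k0 _] := regularP kg.
apply/leq_sizeP => d sd; have := G_vert_top Gk (leq_trans sd (leqnSn d)).
rewrite [_`_d]nth_default // mulr0 => /esym/eqP.
rewrite mulf_eq0 polyC_eq0 mulf_eq0 intr_eq0 (negbTE n0) (negbTE k0) /=.
by move=> /eqP.
Qed.

(** Going from (1,0) to (1,k) by L_(0,k) and back by L_(0,-k) multiplies by the
    structure constants, that is, by q^2 - k^2, while the leading coefficient in y
    is multiplied by the product of the differences p(x) - p(x-1) of both
    polynomials. So these differences are nonzero constants. *)
Lemma G_vert_affine k : regular k -> exists r s r' s' : K,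
  [/\ G (0, k) = (r *: 'X + s%:P)%:P, G (0, - k) = (r' *: 'X + s'%:P)%:P
    & r * r' = q ^+ 2 - k%:~R ^+ 2].
Proof.
move=> kg; have kg' : regular (- k) by rewrite regularN.
have [p Gk] := G_vert_poly kg; have [p' Gk'] := G_vert_poly kg'.
have [_ k1 k2] := regularP kg.
have g0 : G (1, 0) != 0 by rewrite G_neq0.
case E : (size (G (1, 0))) => [|d]; first by rewrite -size_poly_eq0 E in g0.
have E1 := G_vert_top Gk (eq_leq E).
have sk : (size (G (1, k)%R) <= d.+1)%N.
  by have := @size_G_vert k (1, 0) isT kg; rewrite /= add0r E.
have E2 := G_vert_top Gk' (n := (1, k)) sk.
rewrite /= ?add0r subrr ?mul1r rmorphN /= in E1 E2.
pose u := p - xshift 1 p; pose u' := p' - xshift 1 p'.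
have l0 : (G (1, 0))`_d != 0.
  by rewrite -[d]/(d.+1.-1) -E -lead_coefE lead_coef_eq0.
have uu : u * u' = (q ^+ 2 - k%:~R ^+ 2)%:P.
  apply: (mulIf l0); rewrite -mulrA mulrC -mulrA -/u' (mulrC _ u) E1 mulrCA E2.
  by rewrite mulrA -polyCM; congr (_%:P * _); ring.
have [su su'] : size u = 1%N /\ size u' = 1%N.
  by apply: mul_const_size1 uu; rewrite subr_sqr mulf_neq0 // addrC.
have [[r [s [pE uE]]] [r' [s' [pE' uE']]]] :=
  (xshift_diff_affine su, xshift_diff_affine su').
exists r, s, r', s'; rewrite Gk Gk' -pE -pE'; split => //.
by apply: polyC_inj; rewrite -uu /u /u' uE uE' polyCM.
Qed.

Lemma G_horiz_step k r s n : G (0, k) = (r *: 'X + s%:P)%:P ->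
  (r *: 'X + s%:P)%:P * yshift k%:~R (G n)
  - G n * ((r *: 'X + s%:P)%:P - (n.1%:~R * r)%:P%:P) =
  (n.1%:~R * (k%:~R + q))%:P%:P * G (n.1, n.2 + k).
Proof.
move=> Gk; rewrite -(G_vert_step n Gk) -polyCB; congr (_ - _ * _%:P).
rewrite /xshift comp_polyD comp_polyZ comp_polyX comp_polyC -!mul_polyC polyCM.
by ring.
Qed.

(** * Degree one in y *)

(** Elimination of h between the step g -> h by L_(0,k), whose translate by the
    inverse shift is the second hypothesis, and the step h -> g by L_(0,-k). Here
    Sg and S'g stand for the translates of g by k and -k, and A, A' for the
    differences of P and P'. *)
Lemma second_difference (T : comNzRingType) (P P' A A' C D g h Sg S'g S'h : T) :
  P * Sg - g * (P - A) = C * h ->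
  P * g - S'g * (P - A) = C * S'h ->
  P' * S'h - h * (P' - A') = D * g ->
  C * D = A * A' ->
  P' * P * (g + g - Sg - S'g) + A * P' * (S'g - g) + A' * P * (Sg - g) = 0.
Proof.
move=> e1 e2 e3 CD.
have : C * (P' * S'h - h * (P' - A')) - C * D * g = 0 by rewrite e3; ring.
have -> : C * (P' * S'h - h * (P' - A')) = P' * (C * S'h) - C * h * (P' - A').
  by ring.
by rewrite CD -e2 -e1 => <-; ring.
Qed.

(** When P and P' are proportional the equation above becomes a multiple of the
    second difference of g alone. *)
Lemma second_difference_flat (T : comNzRingType) (P P' A A' g Sg S'g : T) :
  A * P' = A' * P ->
  P' * P * (g + g - Sg - S'g) + A * P' * (S'g - g) + A' * P * (Sg - g) = 0 ->
  A' * P * (P - A) * (g + g - Sg - S'g) = 0.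
Proof.
move=> e; rewrite e => h; rewrite -[RHS](mulr0 A) -h.
have -> : A * (P' * P * (g + g - Sg - S'g) + A' * P * (S'g - g)
    + A' * P * (Sg - g)) = A * P' * P * (g + g - Sg - S'g)
    + A * A' * P * (S'g - g) + A * A' * P * (Sg - g) by ring.
by rewrite e; ring.
Qed.

(** The equation of lemma second_difference, read in the degree just below the
    degree of g, forces the polynomials of L_(0,k) and L_(0,-k) to be proportional.
    The second difference of g in y then vanishes, so g is affine in y. *)
Lemma size_G_horiz_le n : n.1 != 0 -> (size (G n) <= 2)%N.
Proof.
move=> n0; have [k kg _] := regular_consecutive.
have [r [s [r' [s' [Gk Gk' rr]]]]] := G_vert_affine kg.
have [k0 k1 k2] := regularP kg.
have nK : n.1%:~R != 0 :> K by rewrite intr_eq0.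
have /andP[r0 r'0] : (r != 0) && (r' != 0).
  by rewrite -negb_or -mulf_eq0 rr subr_sqr mulf_neq0 // addrC.
set g := G n; set p := r *: 'X + s%:P in Gk *; set p' := r' *: 'X + s'%:P in Gk' *.
have e1 := G_horiz_step n Gk; have e3 := G_horiz_step (n.1, n.2 + k) Gk'.
rewrite -/p -/p' /= addrK -surjective_pairing -/g in e1 e3.
set h := G (n.1, _) in e1 e3.
have yK : yshift (- k)%:~R (yshift k%:~R g) = g.
  by apply: ev_inj => x y; rewrite !ev_yshift rmorphN opprK addrK.
have e2 := congr1 (yshift (- k)%:~R) e1.
rewrite /yshift comp_polyB !comp_polyM comp_polyB !comp_polyC -!/(yshift _ _) yK in e2.
have CD : (n.1%:~R * (k%:~R + q))%:P%:P * (n.1%:~R * ((- k)%:~R + q))%:P%:P =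
    (n.1%:~R * r)%:P%:P * (n.1%:~R * r')%:P%:P :> {poly {poly K}}.
  rewrite -!polyCM; congr (_%:P%:P); rewrite rmorphN /= [RHS]mulrACA rr; ring.
have := second_difference e1 e2 e3 CD.
set Sg := yshift k%:~R g; set S'g := yshift (- k)%:~R g.
set A := (n.1%:~R * r)%:P; set A' := (n.1%:~R * r')%:P => star.
case E : (size g) => [|[|d]] //; rewrite -E.
have l0 : g`_d.+1 != 0.
  by rewrite -[d.+1]/(d.+2.-1) -E -lead_coefE lead_coef_eq0 -size_poly_eq0 E.
have prop : A * p' = A' * p.
  have := congr1 (fun P : {poly {poly K}} => P`_d) star.
  rewrite !coefD -!polyCM !coefCM !(coefB, coefD, coefN) /Sg /S'g /yshift.
  rewrite !coef_shift ?E // coef0 rmorphN /= polyCN.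
  set l := g`_d.+1; set c := g`_d; set kk := (k%:~R)%:P : {poly K}.
  rewrite mulNr mulNrn; set t := kk * l *+ d.+1.
  have -> : p' * p * (c + c - (c - t) - (c - - t)) + A * p' * (c - - t - c)
    + A' * p * (c - t - c) = (A * p' - A' * p) * t by ring.
  move=> /eqP; rewrite mulf_eq0 subr_eq0.
  rewrite /t -mulr_natr !mulf_eq0 (negbTE l0) polyC_eq0 (negbTE k0).
  by rewrite (negbTE (natS_poly_neq0 _ _)) !orbF => /eqP.
have flat : g + g - Sg - S'g = 0.
  have : A'%:P * p%:P * (p%:P - A%:P) * (g + g - Sg - S'g) = 0.
    have propP : A%:P * p'%:P = A'%:P * p%:P by rewrite -!polyCM prop.
    exact: second_difference_flat propP star.
  move/eqP; rewrite !mulf_eq0 -polyCB !polyC_eq0 mulf_eq0 (negbTE nK) (negbTE r'0).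
  rewrite (negbTE (affine_neq0 _ r0)) /= => /orP[|/eqP //].
  by rewrite /p -addrA -polyCB (negbTE (affine_neq0 _ r0)).
have nk0 : (- k)%:~R%:P != 0 :> {poly K} by rewrite polyC_eq0 rmorphN oppr_eq0.
have k0P : (k%:~R)%:P != 0 :> {poly K} by rewrite polyC_eq0.
apply: (shift_diff_size (natS_poly_neq0 K) nk0); rewrite -/(yshift _ _) -/S'g.
apply: (shift_invariant_size (natS_poly_neq0 K) k0P); rewrite -/(yshift _ _).
have -> : yshift k%:~R (S'g - g) = g - Sg.
  by apply: ev_inj => x y; rewrite ev_yshift !evE !ev_yshift rmorphN opprK subrK.
by apply/eqP; rewrite -subr_eq0 -[X in _ == X]flat; apply/eqP; ring.
Qed.

(** If L_n acts by a polynomial c(x), the step by a vertical element shows that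
    L_(n + (0,k)) acts by a multiple of the same c(x). Then the two commute,
    although their bracket is a nonzero multiple of an element with nonzero first
    index. *)
Lemma size_G_horiz n : n.1 != 0 -> size (G n) = 2%N.
Proof.
move=> n0; apply/eqP; rewrite eqn_leq size_G_horiz_le // ltnNge; apply/negP => s1.
have [k kg _] := regular_consecutive.
have [r [s [r' [s' [Gk _ _]]]]] := G_vert_affine kg.
have [k0 k1 _] := regularP kg.
have nK : n.1%:~R != 0 :> K by rewrite intr_eq0.
have nn0 : (n + (n.1, n.2 + k)).1 != 0.
  by case: n n0 {s1 nK} => a b /= a0; rewrite -mulr2n mulrn_eq0.
apply/negP: (G_neq0 nn0); rewrite negbK; apply/eqP.
have Gn := size1_polyC s1; set c := (G n)`_0 in Gn.
have Gnk : (k%:~R + q)%:P%:P * G (n.1, n.2 + k) = (r *: c)%:P.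
  apply: (@mulfI _ (n.1%:~R)%:P%:P); first by rewrite !polyC_eq0.
  rewrite mulrA -!polyCM -(G_horiz_step n Gk) Gn /yshift comp_polyC.
  rewrite -!mul_polyC !polyCM; ring.
have evGnk x y : (k%:~R + q) * ev (G (n.1, n.2 + k)) x y = r * c.[x].
  by have := congr1 (fun P => ev P x y) Gnk; rewrite evM !evC hornerC hornerZ.
apply: ev_inj => x y; rewrite [RHS]/ev !horner0.
have e := G_br n (n.1, n.2 + k) x y; rewrite /block_coef /= rmorphD /= in e.
have := mulrBr (k%:~R + q) (ev (G n) x y *
  ev (G (n.1, n.2 + k)) (x - n.1%:~R) (y - n.2%:~R)).
move=> /(_ (ev (G (n.1, n.2 + k)) x y
  * ev (G n) (x - n.1%:~R) (y - (n.2%:~R + k%:~R)))).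
rewrite e [X in _ = X - _]mulrCA evGnk mulrA [X in _ = _ - X]mulrA evGnk Gn !evC.
have -> : c.[x] * (r * c.[x - n.1%:~R]) - r * c.[x] * c.[x - n.1%:~R] = 0 by ring.
have -> : n.1%:~R * (n.2%:~R + q) - n.1%:~R * (n.2%:~R + k%:~R + q)
  = - (n.1%:~R * k%:~R).
  by ring.
move=> /eqP; rewrite !mulf_eq0 oppr_eq0 mulf_eq0 (negbTE k0) (negbTE k1).
by rewrite (negbTE nK) => /eqP.
Qed.

(** * The elements of index (1,0) and (-1,0) *)

(** Write L_(1,0) and L_(-1,0) as A y + C and A' y + C'. Their bracket is
    -2 q L_0, that is, -2 q^2 x. Each power of y in it is a difference equation in
    x: that of y^2 makes A(x) A'(x-1) invariant, hence constant; that of y makes C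
    and C' have the same degree; that of y^0 gives C(x) C'(x-1) degree 2. *)
Lemma G_pm1_affine : exists a c d a' c' d' : K,
  [/\ forall x y, ev (G (1, 0)) x y = a * y + c * x + d,
      forall x y, ev (G (-1, 0)) x y = a' * y + c' * x + d'
    & [/\ a != 0, a' != 0, c * c' = q ^+ 2, a * c' + a' * c = 0
        & c * d' + d * c' = 0]].
Proof.
have s1 := size_G_horiz (n := (1, 0)) isT.
have s1' := size_G_horiz (n := (-1, 0)) isT.
have Gn := ev_size2 _ _ (eq_leq s1); have Gn' := ev_size2 _ _ (eq_leq s1').
have A0 : (G (1, 0))`_1 != 0.
  by rewrite -[1%N]/(2.-1) -s1 -lead_coefE lead_coef_eq0 -size_poly_eq0 s1.
have A'0 : (G (-1, 0))`_1 != 0.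
  by rewrite -[1%N]/(2.-1) -s1' -lead_coefE lead_coef_eq0 -size_poly_eq0 s1'.
set A := (G (1, 0))`_1 in Gn A0; set C := (G (1, 0))`_0 in Gn.
set A' := (G (-1, 0))`_1 in Gn' A'0; set C' := (G (-1, 0))`_0 in Gn'.
have br x : [/\ A.[x] * A'.[x - 1] - A'.[x] * A.[x + 1] = 0,
    A.[x] * C'.[x - 1] + C.[x] * A'.[x - 1]
      - A'.[x] * C.[x + 1] - C'.[x] * A.[x + 1] = 0
  & C.[x] * C'.[x - 1] - C'.[x] * C.[x + 1] + 2%:R * q ^+ 2 * x = 0].
  apply: quadratic_coefs => y.
  have := G_br (1, 0) (-1, 0) x y; rewrite Gn Gn' G_0 /block_coef /= !subr0 opprK.
  rewrite !mulr1z !Gn !Gn' => e; apply/eqP; rewrite -subr_eq0; apply/eqP.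
  rewrite -[RHS](subrr (- 2%:R * q ^+ 2 * x)).
  have {1}<- : (-1 * (0 + q) - 1 * (0 + q)) * (q * x) = - 2%:R * q ^+ 2 * x by ring.
  by rewrite -e; ring.
have [u uE] : exists u, A * xshift 1 A' = u%:P.
  apply: (xshift_invariant_const (oner_neq0 K)) => x.
  rewrite !hornerM !horner_xshift; have [e _ _] := br (x - 1).
  by move/eqP: e; rewrite subr_eq0 subrK => /eqP ->; rewrite mulrC.
have xA'0 : xshift 1 A' != 0 by rewrite -size_poly_eq0 size_xshift size_poly_eq0.
have [sA sxA'] : size A = 1%N /\ size (xshift 1 A') = 1%N.
  by apply: (mul_const_size1 _ uE); rewrite -polyC_eq0 -uE mulf_neq0.
rewrite size_xshift in sxA'.
have /size1_polyC AE : (size A <= 1)%N by rewrite sA.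
have /size1_polyC AE' : (size A' <= 1)%N by rewrite sxA'.
set a := A`_0 in AE; set a' := A'`_0 in AE'.
have a0 : a != 0 by rewrite -polyC_eq0 -AE.
have a'0 : a' != 0 by rewrite -polyC_eq0 -AE'.
have [w wE] : exists w, a *: xshift 1 C' + a' *: C = w%:P.
  apply: (xshift_invariant_const (oner_neq0 K)) => x.
  rewrite !hornerD !hornerZ !horner_xshift; have [_ e _] := br (x - 1).
  apply/eqP; rewrite -subr_eq0; apply/eqP; rewrite -[RHS]e AE AE' !hornerC subrK; ring.
(* q^2 (x^2 - x) is the solution of V(x+1) - V(x) = 2 q^2 x without constant term. *)
have [v vE] : exists v, C * xshift 1 C' - q ^+ 2 *: ('X ^+ 2 - 'X) = v%:P.
  apply: (xshift_invariant_const (oner_neq0 K)) => x; rewrite !hornerE.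
  rewrite !horner_xshift; have [_ _ e] := br (x - 1).
  apply/eqP; rewrite -subr_eq0; apply/eqP; rewrite -[RHS]e subrK; ring.
have sCC : size (C * xshift 1 C') = 3%N.
  have -> : C * xshift 1 C' = q ^+ 2 *: ('X ^+ 2 - 'X) + v%:P.
    by rewrite -vE addrC subrK.
  have s3 : size (q ^+ 2 *: ('X ^+ 2 - 'X) : {poly K}) = 3%N.
    rewrite size_scale ?expf_neq0 //.
    by rewrite size_polyDl ?size_polyN ?size_polyXn ?size_polyX.
  by rewrite size_polyDl s3 // size_polyC; case: (v != 0).
have /andP[C0 xC'0] : (C != 0) && (xshift 1 C' != 0).
  by rewrite -negb_or -mulf_eq0 -size_poly_eq0 sCC.
have sCC' : (size C + size C' = 4)%N.
  have := size_mul C0 xC'0; rewrite sCC size_xshift.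
  by case: (size C + size C')%N => [|i] //= ->.
have sw b : (size (w%:P - b)%R <= maxn 1 (size b))%N.
  apply: (leq_trans (size_polyD _ _)).
  rewrite size_polyN size_polyC geq_max leq_maxr andbT.
  by rewrite (leq_trans (leq_b1 _)) // leq_maxl.
have sCle : (size C <= maxn 1 (size C'))%N.
  have := sw (a *: xshift 1 C'); rewrite -wE addrC addKr.
  by rewrite !size_scale // size_xshift.
have sC'le : (size C' <= maxn 1 (size C))%N.
  have := sw (a' *: C); rewrite -wE addrK.
  by rewrite !size_scale // size_xshift.
have [sC sC'] : (size C <= 2)%N /\ (size C' <= 2)%N.
  by move: sCC' sCle sC'le; lia.
exists a, C`_1, C`_0, a', C'`_1, C'`_0; split => [x y|x y|].
- by rewrite Gn AE hornerC horner_size2 // addrA.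
- by rewrite Gn' AE' hornerC horner_size2 // addrA.
have br' x : a * C'`_1 + a' * C`_1 = 0 /\
    0 * x ^+ 2 + 2%:R * (q ^+ 2 - C`_1 * C'`_1) * x - (C`_1 * C'`_0 + C`_0 * C'`_1) = 0.
  have [_] := br x; rewrite AE AE' !hornerC !(horner_size2 _ sC) !(horner_size2 _ sC').
  move=> e1 e2; split; last by rewrite -[RHS]e2; ring.
  by apply: oppr_inj; rewrite oppr0 -[RHS]e1; ring.
have [_ e3 e4] := quadratic_coefs (fun x => proj2 (br' x)).
split => //; last 1 first.
- by apply: oppr_inj; rewrite oppr0.
- by move/eqP: e3; rewrite mulf_eq0 pnatr_eq0 subr_eq0 => /eqP.
- exact: proj1 (br' 0).
Qed.

(** The element L_(1,k) is reached from L_(1,0) by L_(0,k); its bracket with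
    L_(-1,0) is again a multiple of L_(0,k). The two relations are the coefficients
    of x and 1 in this closed loop. *)
Lemma regular_vert_relation k a c d a' c' d' : regular k ->
  (forall x y, ev (G (1, 0)) x y = a * y + c * x + d) ->
  (forall x y, ev (G (-1, 0)) x y = a' * y + c' * x + d') ->
  a * c' + a' * c = 0 ->
  exists2 r, r != 0 & exists s, [/\ forall x y, ev (G (0, k)) x y = r * x + s,
    (c - k%:~R * a) * (a' * k%:~R + c' *+ 2) = (k%:~R + q) * (k%:~R + q *+ 2)
  & (r * d - k%:~R * a * s) * (a' * k%:~R + c') + d' * r * (c - k%:~R * a)
      = (k%:~R + q) * (k%:~R + q *+ 2) * s].
Proof.
move=> kg E E' ac; have [k0 k1 k2] := regularP kg.
have [r [s [r' [s' [Gk _ rr]]]]] := G_vert_affine kg.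
have r0 : r != 0.
  apply: contraTneq kg => r0; rewrite /regular -[_ ^+ 2 == _]subr_eq0 -opprB -rr r0.
  by rewrite mul0r oppr0 eqxx andbF.
have E0 x y : ev (G (0, k)) x y = r * x + s.
  by rewrite Gk evC hornerD hornerZ hornerX hornerC.
have E1 x y : (k%:~R + q) * ev (G (1, k)) x y =
    r * (a * y + c * x + d) - k%:~R * a * (r * x + s).
  have := G_br (0, k) (1, 0) x y; rewrite vert_add /block_coef /= !mulr1z !mulr0z.
  by rewrite !subr0 !E !E0 mul1r mul0r subr0 add0r => <-; ring.
have main x : r * (c - k%:~R * a) * (a' * k%:~R + c') * x
    + (r * d - k%:~R * a * s) * (a' * k%:~R + c')
    + (c' * x + d') * r * (c - k%:~R * a)
    = (k%:~R + q) * (k%:~R + q *+ 2) * (r * x + s).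
  have := G_br (1, k) (-1, 0) x 0; rewrite pm1_add.
  rewrite /block_coef /= !mulr0z subr0 mulrN1z opprK mulr1z E0 !E'.
  move: (E1 x 0) (E1 (x + 1) 0).
  set u := ev _ x 0; set u' := ev _ (x + 1) 0 => e1 e2 e.
  have -> : (k%:~R + q) * (k%:~R + q *+ 2) * (r * x + s) =
    - ((k%:~R + q) * ((-1 * (k%:~R + q) - 1 * (0 + q)) * (r * x + s))) by ring.
  have comm A B : (k%:~R + q) * (u * A - B * u') =
    (k%:~R + q) * u * A - B * ((k%:~R + q) * u') by ring.
  by rewrite -e comm e1 e2; ring.
exists r => //; exists s; split => //; last by have := main 0; rewrite !(mulr0, add0r).
apply: (mulIf r0).
have -> : (k%:~R + q) * (k%:~R + q *+ 2) * r =
  (k%:~R + q) * (k%:~R + q *+ 2) * (r * 1 + s)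
  - (k%:~R + q) * (k%:~R + q *+ 2) * (r * 0 + s).
  by ring.
by rewrite -!main; ring.
Qed.

(** The first relation of the previous lemma amounts to k (1 + a a') = 3 (c a' - q).
    Since this holds for two values of k both sides vanish, which determines
    L_(1,0) and L_(-1,0) up to the two parameters l and alpha. The second relation
    then becomes 2 q s = 0. *)
Lemma G_generators : exists l a : K, [/\ l != 0,
    forall x y, ev (G (1, 0)) x y = l * weight a (1, 0) x y,
    forall x y, ev (G (-1, 0)) x y = l^-1 * weight a (-1, 0) x y
  & forall k, regular k -> exists2 r, r != 0 &
      forall x y, ev (G (0, k)) x y = r * weight a (0, k) x y].
Proof.
have [a [c [d [a' [c' [d' [E E' [a0 a'0 cc ac cd]]]]]]]] := G_pm1_affine.
have rel k : regular k -> k%:~R * (1 + a * a') = 3%:R * (c * a' - q).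
  move=> kg; have [k0 _ _] := regularP kg.
  have [r _ [s [_ e _]]] := regular_vert_relation kg E E' ac.
  apply: (mulfI k0); apply/eqP; rewrite -subr_eq0; apply/eqP.
  have -> : k%:~R * (k%:~R * (1 + a * a')) - k%:~R * (3%:R * (c * a' - q)) =
    (k%:~R + q) * (k%:~R + q *+ 2) - (c - k%:~R * a) * (a' * k%:~R + c' *+ 2)
    + (c * c' - q ^+ 2) *+ 2 - k%:~R * (a * c' + a' * c) *+ 2 by ring.
  by rewrite e cc ac; ring.
have aa : a * a' = - 1.
  have [j /rel j1 /rel j2] := regular_consecutive.
  apply/eqP; rewrite -addr_eq0 addrC; apply/eqP.
  have -> : 1 + a * a' = (j + 1)%:~R * (1 + a * a') - j%:~R * (1 + a * a').
    by rewrite rmorphD; ring.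
  by rewrite j1 j2 subrr.
have ca : c * a' = q.
  have [j /rel + _] := regular_consecutive; rewrite aa subrr mulr0 => /esym/eqP.
  by rewrite mulf_eq0 pnatr_eq0 /= subr_eq0 => /eqP.
have a'E : a' = - a^-1.
  by apply: (mulfI a0); rewrite aa mulrN mulfV.
have cE : c = - (q * a).
  by rewrite -ca -mulrA (mulrC a') aa mulrN1 opprK.
have c0 : c != 0 by rewrite cE oppr_eq0 mulf_neq0.
have c'E : c' = - (q * a^-1).
  by apply: (mulfI c0); rewrite cc cE; field.
have d'E : d' = d * a^-1 * - a^-1.
  apply: (mulfI c0); apply/eqP; rewrite -subr_eq0; apply/eqP.
  by rewrite -[RHS]cd c'E cE; field.
(* The values come from matching a y - q a x + d with l (q x - q alpha - y). *)
exists (- a), (d / a / q); rewrite oppr_eq0; split => // [x y|x y|k kg].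
- by rewrite E /weight /= cE mulr0z mulr1z; field; rewrite q0 a0.
- by rewrite E' /weight /= a'E d'E c'E mulr0z mulrN1z; field; rewrite ?oppr_eq0 q0 a0.
have [k0 k1 _] := regularP kg.
have [r r0 [s [E0 _ e]]] := regular_vert_relation kg E E' ac.
have s0 : s = 0.
  move: e; rewrite d'E a'E c'E cE.
  have -> : (r * d - k%:~R * a * s) * (- a^-1 * k%:~R + - (q * a^-1)) +
    d * a^-1 * - a^-1 * r * (- (q * a) - k%:~R * a)
    = (k%:~R + q) * (k%:~R * s) by field.
  rewrite -mulrA => /(mulfI k1)/eqP; rewrite mulrDl -subr_eq0 opprD.
  by rewrite addrA subrr sub0r oppr_eq0 mulf_eq0 mulrn_eq0 (negbTE q0) => /eqP.
exists (r / (k%:~R + q)); first by rewrite mulf_neq0 // invr_eq0.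
by move=> x y; rewrite E0 s0 /weight /= mulr0z; field; rewrite q0 a0.
Qed.

(** * From the generators to the whole algebra *)

Lemma weight_vert_step k n r c a : regular k -> n.1 != 0 ->
  (forall x y, ev (G (0, k)) x y = r * weight a (0, k) x y) ->
  (forall x y, ev (G n) x y = c * weight a n x y) ->
  forall x y, ev (G (n.1, n.2 + k)) x y = r * c * weight a (n.1, n.2 + k) x y.
Proof.
move=> kg n0 E0 En x y; have [_ k1 _] := regularP kg.
have nK : n.1%:~R != 0 :> K by rewrite intr_eq0.
apply: (mulfI (mulf_neq0 nK k1)).
have := G_br (0, k) n x y; rewrite vert_add /block_coef !E0 !En.
rewrite /weight /= !mulr0z !mul0r !rmorphD /= !subr0 => <-; ring.
Qed.

Definition omega (l1 l2 a : K) m x y : K := l1 ^ m.1 * l2 ^ m.2 * weight a m x y.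

(** The structure polynomials of Omega satisfy the bracket relation, so agreement
    with Omega passes from two elements to their bracket. *)
Lemma omega_br (l1 l2 a : K) m n x y : l1 != 0 -> l2 != 0 ->
  omega l1 l2 a m x y * omega l1 l2 a n (x - m.1%:~R) (y - m.2%:~R)
  - omega l1 l2 a n x y * omega l1 l2 a m (x - n.1%:~R) (y - n.2%:~R)
  = block_coef q m n * omega l1 l2 a (m + n) x y.
Proof.
move=> l10 l20; rewrite /omega /weight /block_coef !expfzDr // !rmorphD /=.
move: (l1 ^ m.1) (l1 ^ n.1) (l2 ^ m.2) (l2 ^ n.2) => u v w z.
move: (m.1%:~R : K) (m.2%:~R : K) (n.1%:~R : K) (n.2%:~R : K) => *; ring.
Qed.

(** The relation r r' = q^2 - k^2 between the slopes of L_(0,k) and L_(0,-k). *)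
Lemma vert_scalarN k r r' a : regular k ->
  (forall x y, ev (G (0, k)) x y = r * weight a (0, k) x y) ->
  (forall x y, ev (G (0, - k)) x y = r' * weight a (0, - k) x y) ->
  r * r' = 1.
Proof.
move=> kg E E'; have [k0 k1 k2] := regularP kg.
have [s [t [s' [t' [Gk Gk' ss]]]]] := G_vert_affine kg.
have aff u v w : (forall x, u * x + v = w * x) -> u = w.
  move=> h; have := h 0; have := h 1.
  by rewrite !mulr1 !mulr0 add0r => + v0; rewrite v0 addr0.
have sE : s = r * (k%:~R + q).
  apply: (aff _ t) => x; have := E x 0.
  rewrite Gk evC hornerD hornerZ hornerX hornerC => ->.
  by rewrite /weight /= mulr0z; ring.
have sE' : s' = r' * (q - k%:~R).
  apply: (aff _ t') => x; have := E' x 0.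
  rewrite Gk' evC hornerD hornerZ hornerX hornerC => ->.
  by rewrite /weight /= mulr0z rmorphN; ring.
apply: (mulIf (mulf_neq0 k1 k2)).
have -> : r * r' * ((k%:~R + q) * (q - k%:~R)) = s * s' by rewrite sE sE'; ring.
by rewrite ss; ring.
Qed.

Definition agrees (l1 l2 a : K) m :=
  forall x y, ev (G m) x y = omega l1 l2 a m x y.

(** With j and j + 1 regular, a step up by j + 1 followed by a step down by j moves
    one place along a column, and multiplies the scalar by a constant; this constant
    is lambda_2, and the opposite moves multiply by its inverse. *)
Lemma G_columns : exists l1 l2 a : K, [/\ l1 != 0, l2 != 0,
    forall i, agrees l1 l2 a (1, i), forall i, agrees l1 l2 a (-1, i)
  & forall k, regular k -> exists r,
      forall x y, ev (G (0, k)) x y = r * weight a (0, k) x y].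
Proof.
have [l [a [l0 E E' Ev]]] := G_generators.
have [j jg jg1] := regular_consecutive.
have jgN : regular (- j) by rewrite regularN.
have jg1N : regular (- (j + 1)) by rewrite regularN.
have [r r0 er] := Ev _ jg; have [r' r'0 er'] := Ev _ jg1.
have [t t0 et] := Ev _ jgN; have [t' t'0 et'] := Ev _ jg1N.
have rt := vert_scalarN jg er et; have rt' := vert_scalarN jg1 er' et'.
pose l2 := r' * t.
have l20 : l2 != 0 by rewrite mulf_neq0.
have l2V : l2^-1 = t' * r.
  by apply: (mulfI l20); rewrite mulfV // /l2 mulrACA rt' mul1r mulrC rt.
pose ok := agrees l l2 a.
have up b i : b != 0 -> ok (b, i) -> ok (b, i + 1).
  move=> b0 h x y.
  have h1 := weight_vert_step jg1 (n := (b, i)) b0 er' h.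
  have := weight_vert_step jgN (n := (b, i + (j + 1))) b0 et h1 x y.
  have -> : (b, i + (j + 1)).2 - j = i + 1 by rewrite /=; ring.
  rewrite /= => ->.
  by rewrite /omega /= expfzDr // expr1z /l2; ring.
have down b i : b != 0 -> ok (b, i) -> ok (b, i - 1).
  move=> b0 h x y.
  have h1 := weight_vert_step jg1N (n := (b, i)) b0 et' h.
  have := weight_vert_step jg (n := (b, i - (j + 1))) b0 er h1 x y.
  have -> : (b, i - (j + 1)).2 + j = i - 1 by rewrite /=; ring.
  rewrite /= => ->.
  by rewrite /omega /= expfzDr // exprN1 l2V; ring.
have column b : b != 0 -> ok (b, 0) -> forall i, ok (b, i).
  move=> b0 h; elim/int_ind => // i IH.
    by rewrite -addn1 PoszD; apply: up.
  by rewrite -addn1 PoszD opprD; apply: down.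
have ok1 : forall i, ok (1, i).
  by apply: column => // x y; rewrite E /omega /= expr1z expr0z mulr1.
have okN1 : forall i, ok (-1, i).
  by apply: column => // x y; rewrite E' /omega /= expr0z mulr1.
exists l, l2, a; split=> // k /Ev[s _ es]; by exists s.
Qed.

(** Brackets with the columns of first index 1 and -1 generate everything except
    possibly L_(0,-2q), which is not in the derived algebra when 2q is an integer.
    But -2q is regular, so this element is known up to a scalar, and the scalar is
    read off from its action on L_(1,0). *)
Lemma G_classification : exists l1 l2 a : K, [/\ l1 != 0, l2 != 0 &
  forall m, agrees l1 l2 a m].
Proof.
have [l [l2 [a [l0 l20 ok1 okN1 Ev]]]] := G_columns.
have okD m n : block_coef q m n != 0 -> agrees l l2 a m ->
    agrees l l2 a n -> agrees l l2 a (m + n).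
  move=> c0 hm hn x y; apply: (mulfI c0).
  by rewrite -G_br -omega_br // !hm !hn.
(* The coefficient of the bracket of (1, b) and (i+1, k-b) is affine in b with
     nonzero slope, so b = 0 or b = 1 works. *)
have choose (u v : K) : u != 0 -> exists i : int, u * i%:~R + v != 0.
  move=> u0; have [v0|] := eqVneq v 0; last by exists 0; rewrite mulr0 add0r.
  by exists 1; rewrite v0 addr0 mulr1.
have okpos (i : nat) : forall k, agrees l l2 a (i.+1%:Z, k).
  elim: i => [|i IH] k; first exact: ok1.
  have [b bP] := choose i.+2%:R (i%:R * q - k%:~R) (natS_neq0 K _).
  have -> : (i.+2%:Z, k) = (1, b) + (i.+1%:Z, k - b) :> (int * int)%type.
    by rewrite -[RHS]/(1 + i.+1%:Z, b + (k - b)) (addrC b) subrK.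
  apply: okD => //; rewrite /block_coef /= rmorphB /=.
  have -> : i.+1%:~R * (b%:~R + q) - 1%:~R * (k%:~R - b%:~R + q) =
    i.+2%:R * b%:~R + (i%:R * q - k%:~R) :> K.
    by rewrite -!pmulrn !mulrS; ring.
  by [].
have okneg (i : nat) : forall k, agrees l l2 a (- i.+1%:Z, k).
  elim: i => [|i IH] k; first exact: okN1.
  have [b bP] := choose i.+2%:R (i%:R * q - k%:~R) (natS_neq0 K _).
  have -> : (- i.+2%:Z, k) = (-1, b) + (- i.+1%:Z, k - b) :> (int * int)%type.
    rewrite -[RHS]/(-1 - i.+1%:Z, b + (k - b)) (addrC b) subrK; congr pair.
  apply: okD => //; rewrite /block_coef /= !rmorphN rmorphB /=.
  have -> : - i.+1%:~R * (b%:~R + q) - - 1%:~R * (k%:~R - b%:~R + q) =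
    - (i.+2%:R * b%:~R + (i%:R * q - k%:~R)) :> K.
    by rewrite -!pmulrn !mulrS; ring.
  by rewrite oppr_eq0.
have okvert k : agrees l l2 a (0, k).
  have [kq|kq] := eqVneq (k%:~R + q *+ 2) 0; last first.
    rewrite -pm1_add; apply: okD => //; rewrite /block_coef /= mulr0z rmorphN /=.
    have -> : -1 * (k%:~R + q) - 1 * (0 + q) = - (k%:~R + q *+ 2) by ring.
    by rewrite oppr_eq0.
  have kE : k%:~R = - (q *+ 2) by apply/eqP; rewrite -addr_eq0 kq.
  have kg : regular k.
    rewrite /regular -(intr_eq0 K) kE oppr_eq0 mulrn_eq0 (negbTE q0) /=.
    have -> : (- (q *+ 2)) ^+ 2 = q ^+ 2 *+ 3 + q ^+ 2 by ring.
    by rewrite -subr_eq0 addrK mulrn_eq0 expf_eq0 (negbTE q0).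
  have [s es] := Ev _ kg.
  have := weight_vert_step kg (n := (1, 0)) isT es (ok1 0) 0 (1 - q * a).
  rewrite /= add0r ok1 /omega /weight /= mulr1z mul0r sub0r mul1r.
  rewrite addrC subrK expr0z mulr1.
  rewrite !mulrN1 => /oppr_inj; rewrite expr1z mulrC => /(mulIf l0) sE x y.
  by rewrite es /omega /= expr0z mul1r sE.
exists l, l2, a; split=> //; case=> [[[|i]|i] k].
- exact: okvert.
- exact: okpos.
- exact: okneg.
Qed.

End Core.

(** * Multivariate polynomials as iterated polynomials *)

Section TwoVariables.
Context (K : numFieldType).
Implicit Types (p r : {mpoly K[2]}) (x y : K).

Definition mev p x y : K := p.@[fun i : 'I_2 => if val i == 0%N then x else y].

Lemma mevZ c p x y : mev (c *: p) x y = c * mev p x y.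
Proof. exact: mevalZ. Qed.
Lemma mevM p r x y : mev (p * r) x y = mev p x y * mev r x y.
Proof. exact: mevalM. Qed.
Lemma mevB p r x y : mev (p - r) x y = mev p x y - mev r x y.
Proof. exact: mevalB. Qed.
Lemma mevD p r x y : mev (p + r) x y = mev p x y + mev r x y.
Proof. exact: mevalD. Qed.
Lemma mevC c x y : mev c%:MP x y = c.
Proof. exact: mevalC. Qed.
Lemma mev_int (c : int) x y : mev c%:~R x y = c%:~R.
Proof. by rewrite -(rmorph_int (@mpolyC 2 K)) mevC. Qed.
Lemma mevX0 x y : mev 'X_0 x y = x.
Proof. exact: mevalXU. Qed.
Lemma mevX1 x y : mev 'X_1 x y = y.
Proof. exact: mevalXU. Qed.
Definition mevE := (mevZ, mevM, mevB, mevD, mevC, mev_int, mevX0, mevX1).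

Lemma mev_shift m p x y :
  mev (shift_poly m p) x y = mev p (x - m.1%:~R) (y - m.2%:~R).
Proof.
rewrite /mev /shift_poly comp_mpoly_meval; apply: meval_eq => i.
rewrite (tnth_nth 0) /=; case: i => [[|[|]]] //= ?;
  by rewrite mevalB mevalXU -(rmorph_int (@mpolyC 2 K)) mevalC.
Qed.

Definition curry_mpoly p : {poly {poly K}} :=
  mmap (polyC \o polyC) (fun i : 'I_2 => if val i == 0%N then 'X%:P else 'X) p.

Lemma curry_mpolyE p : curry_mpoly p =
  \sum_(m <- msupp p) (p@_m)%:P%:P * ('X ^+ m 0)%:P * 'X ^+ m 1.
Proof.
rewrite /curry_mpoly /mmap; apply: eq_bigr => m _.
rewrite /mmap1 big_ord_recl big_ord1 /= polyC_exp mulrA.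
by congr (_ * _ ^+ m _); apply: val_inj.
Qed.

Lemma ev_curry p x y : ev (curry_mpoly p) x y = mev p x y.
Proof.
rewrite curry_mpolyE /mev mevalE /ev !horner_sum; apply: eq_bigr => m _.
rewrite !hornerM !hornerC !hornerXn -polyC_exp !hornerC big_ord_recl big_ord1 /= mulrA.
by congr (_ * _ ^+ _ * _ ^+ m _); apply: val_inj.
Qed.

(** Currying loses nothing, so a polynomial in two variables is determined by its
    values. *)
Lemma coef_curry p (n : 'X_{1..2}) : (curry_mpoly p)`_(n 1)`_(n 0) = p@_n.
Proof.
rewrite [in RHS](mpolyE p) curry_mpolyE raddf_sum !coef_sum; apply: eq_bigr => m _ /=.
rewrite mcoeffZ mcoeffX -polyCM coefCM coefXn mulr_natr coefMn coefCM coefXn.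
rewrite mulr_natr -mulrnA mulnb mulr_natr; congr (_ *+ nat_of_bool _).
apply/andP/eqP => [[/eqP e0 /eqP e1]|->] //; apply/mnmP => -[[|[|]]] //= i.
- by rewrite (_ : Ordinal i = 0) //; apply: val_inj.
- by rewrite (_ : Ordinal i = 1) //; apply: val_inj.
Qed.

Lemma mev_inj p r : (forall x y, mev p x y = mev r x y) -> p = r.
Proof.
move=> h; have e : curry_mpoly p = curry_mpoly r.
  by apply: ev_inj => x y; rewrite !ev_curry.
by apply/mpolyP => n; rewrite -!coef_curry e.
Qed.

End TwoVariables.

(** * From modules of rank one to structure polynomials *)

Section LieModuleTheory.
Context (K : fieldType) (L : lieAlgType K) (M : lieModType L).
Implicit Types (u v : M).

Lemma actD_lie (x y : L) v : lie_act (x + y) v = lie_act x v + lie_act y v.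
Proof. by have := lie_act_linearl v 1 x y; rewrite !scale1r. Qed.
Lemma act0_lie v : lie_act (0 : L) v = 0.
Proof. by apply: (addIr (lie_act 0 v)); rewrite -actD_lie !add0r. Qed.
Lemma actZ_lie (c : K) (x : L) v : lie_act (c *: x) v = c *: lie_act x v.
Proof. by have := lie_act_linearl v c x 0; rewrite !addr0 act0_lie addr0. Qed.
Lemma lie_actD (x : L) u v : lie_act x (u + v) = lie_act x u + lie_act x v.
Proof. by have := lie_act_linearr x 1 u v; rewrite !scale1r. Qed.
Lemma lie_act0 (x : L) : lie_act x (0 : M) = 0.
Proof. by apply: (addIr (lie_act x 0)); rewrite -lie_actD !add0r. Qed.
Lemma lie_actZ (c : K) (x : L) v : lie_act x (c *: v) = c *: lie_act x v.
Proof. by have := lie_act_linearr x c v 0; rewrite !addr0 lie_act0 addr0. Qed.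

End LieModuleTheory.

Section Transfer.
Context (K : numFieldType) (q : K) (q0 : q != 0) (M : lieModType (eblock q)).
Implicit Types (p r : {mpoly K[2]}) (u v : M) (m n : int * int).

Local Notation L m := (lie_act (ebL q m) : M -> M).

Lemma act_X0 v : Uh_act 'X_0 v = lie_act (ebd1 q) v.
Proof. exact: Uh_restr_X0. Qed.
Lemma act_X1 v : Uh_act 'X_1 v = lie_act (ebd2 q) v.
Proof. exact: Uh_restr_X1. Qed.
Lemma act_C (c : K) v : Uh_act c%:MP v = c *: v.
Proof. exact: Uh_restr_C. Qed.
Lemma act_Z (c : K) p v : Uh_act (c *: p) v = c *: Uh_act p v.
Proof. by rewrite -mul_mpolyC -Uh_actA act_C. Qed.
Lemma act_0 v : Uh_act 0 v = 0.
Proof. by rewrite /Uh_act msupp0 big_nil. Qed.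
Lemma act_int (c : int) v : Uh_act c%:~R v = c%:~R *: v.
Proof. by rewrite -(rmorph_int (@mpolyC 2 K)) act_C. Qed.
Lemma act_N p v : Uh_act (- p) v = - Uh_act p v.
Proof. by rewrite -scaleN1r act_Z scaleN1r. Qed.
Lemma act_B p r v : Uh_act (p - r) v = Uh_act p v - Uh_act r v.
Proof. by rewrite Uh_actDl act_N. Qed.

Lemma L_X0 m v : L m (Uh_act 'X_0 v) = Uh_act ('X_0 - m.1%:~R) (L m v).
Proof.
rewrite act_B !act_X0 act_int -actZ_lie -(ebd1_brL m q0) lie_act_br.
by rewrite opprB addrC subrK.
Qed.

Lemma L_X1 m v : L m (Uh_act 'X_1 v) = Uh_act ('X_1 - m.2%:~R) (L m v).
Proof.
rewrite act_B !act_X1 act_int -actZ_lie -(ebd2_brL q m) lie_act_br.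
by rewrite opprB addrC subrK.
Qed.

(** The bracket of L_m with d_1 and d_2 says that moving L_m past a variable
    translates the variable, hence L_m is determined by the image of the generator. *)
Lemma L_semilinear m p v : L m (Uh_act p v) = Uh_act (shift_poly m p) (L m v).
Proof.
pose ok p := forall v, L m (Uh_act p v) = Uh_act (shift_poly m p) (L m v).
have okM a b : ok a -> ok b -> ok (a * b).
  by move=> ha hb u; rewrite -Uh_actA ha hb Uh_actA -shift_polyM.
have okX a k : ok a -> ok (a ^+ k).
  move=> ha; elim: k => [|k IH]; last by rewrite exprS; apply: okM.
  by move=> u; rewrite expr0 /shift_poly comp_mpoly1 !Uh_act1.
have ok0 : ok 'X_0 by move=> u; rewrite L_X0 shift_polyX0.
have ok1 : ok 'X_1 by move=> u; rewrite L_X1 shift_polyX1.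
suff : ok p by apply.
elim/mpolyind: p => [|c n p _ _ IH] u.
  by rewrite act_0 lie_act0 /shift_poly raddf0 act_0.
have okn : ok 'X_[n].
  rewrite mpolyXE_id big_ord_recl big_ord1; apply: okM; apply: okX.
    by rewrite (_ : ord0 = 0) //; apply: val_inj.
  by rewrite (_ : fintype.lift _ _ = 1) //; apply: val_inj.
rewrite Uh_actDl act_Z lie_actD lie_actZ IH okn.
by rewrite shift_poly_linear Uh_actDl act_Z.
Qed.

Lemma rank1_generator : Uh_free_of_rank M 1%N ->
  exists w : M, forall v, exists! p, v = Uh_act p w.
Proof.
case=> w wP; exists (w ord0) => v; have [c [cE cU]] := wP v.
exists (c ord0); split; first by rewrite {1}cE big_ord1.
move=> p pE; have -> : c = [ffun=> p] by apply: cU; rewrite big_ord1 ffunE.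
by rewrite ffunE.
Qed.

(** The relations of the algebra applied to the generator, written as identities
    between the polynomials that describe the images of the generator. *)
Lemma rank1_structure_mev (w : M) (g : int * int -> {mpoly K[2]}) :
  (forall p r, Uh_act p w = Uh_act r w -> p = r) ->
  (forall m, L m w = Uh_act (g m) w) ->
  (forall x y, mev (g 0) x y = q * x) /\
  (forall m n x y,
    mev (g m) x y * mev (g n) (x - m.1%:~R) (y - m.2%:~R)
    - mev (g n) x y * mev (g m) (x - n.1%:~R) (y - n.2%:~R)
    = block_coef q m n * mev (g (m + n)) x y).
Proof.
move=> inj gE; split=> [x y|m n x y].
  have -> : g 0 = q *: 'X_0.
    apply: inj; rewrite -gE act_Z act_X0 /ebd1 actZ_lie scalerA mulfV //.
    by rewrite scale1r.
  by rewrite !mevE.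
have LL m' n' : L m' (L n' w) = Uh_act (shift_poly m' (g n') * g m') w.
  by rewrite (gE n') L_semilinear gE Uh_actA.
have e : block_coef q m n *: g (m + n) =
    g m * shift_poly m (g n) - g n * shift_poly n (g m).
  apply: inj; rewrite act_B act_Z -gE -actZ_lie ![g _ * _]mulrC -!LL -lie_act_br.
  congr (lie_act _ w); congr pair; rewrite /= ?scaler0 //.
  by rewrite !scale0r addr0 subr0 -[RHS]/(block_br _ _) block_brL.
by rewrite -!mev_shift -!mevM -mevB -mevZ e.
Qed.

(** The isomorphism sends a vector to its coordinate on the generator. It is
    enough to check equivariance on the L_m, where it is the classification of the
    structure polynomials, and on d_2, where it is multiplication by y. *)
Lemma rank1_Omega : Uh_free_of_rank M 1%N ->
  exists (l1 l2 a : K) (l10 : l1 != 0) (l20 : l2 != 0),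
    lie_isomorphic M (Omega q a l10 l20).
Proof.
case/rank1_generator=> w wP.
have inj p r : Uh_act p w = Uh_act r w -> p = r.
  by move=> e; have [s [_ sU]] := wP (Uh_act p w); rewrite -(sU p) // -(sU r).
have ex v : exists p, v == Uh_act p w by have [p [-> _]] := wP v; exists p.
pose f v : {mpoly K[2]} := xchoose (ex v).
have fE v : Uh_act (f v) w = v by apply/esym/eqP/(xchooseP (ex v)).
have fK p : f (Uh_act p w) = p by apply: inj; rewrite fE.
pose g m := f (L m w).
have gE m : L m w = Uh_act (g m) w by rewrite fE.
have [g0 gbr] := rank1_structure_mev inj gE.
have [] := @G_classification K q q0 (fun m => curry_mpoly (g m)).
- by move=> m n x y; rewrite /= !ev_curry gbr.
- by move=> x y; rewrite /= ev_curry g0.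
move=> l1 [l2 [a [l10 l20 Gom]]]; exists l1, l2, a, l10, l20.
have gOmega m p : Omega_actL q l1 l2 a m p = shift_poly m p * g m.
  rewrite /Omega_actL scalerAl mulrC; congr (_ * _).
  apply: mev_inj => x y; rewrite -[RHS]ev_curry Gom /omega /weight !mevE.
  by [].
have flin : linear f.
  by move=> c u v; apply: inj; rewrite fE Uh_actDl act_Z !fE.
pose F : {linear M -> Omega q a l10 l20} :=
  HB.pack (f : M -> Omega q a l10 l20)
    (GRing.isLinear.Build K M (Omega q a l10 l20) _ f flin).
exists F; split; first by exists (fun p => Uh_act p w); [exact: fE | exact: fK].
suff eqv (u : eblock q) (p : Omega q a l10 l20) :
    Uh_act (lie_act u p : {mpoly K[2]}) w = lie_act u (Uh_act p w).
  by move=> u v; apply: inj; rewrite eqv /= !fE.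
have eqvL m : Uh_act (lie_act (ebL q m) p : {mpoly K[2]}) w = L m (Uh_act p w).
  by rewrite Omega_L gOmega L_semilinear gE Uh_actA.
have eqvB (x : block q) : Uh_act (lie_act ((x, 0) : eblock q) p : {mpoly K[2]}) w =
    lie_act ((x, 0) : eblock q) (Uh_act p w).
  have pairD c (y z : block q) : (c *: y + z, 0) = c *: (y, 0) + (z, 0) :> eblock q.
    by congr pair; rewrite /= scaler0 addr0.
  move: x; apply: freeg_linear_ext => [c y z|c y z|m]; last exact: eqvL.
    by rewrite pairD actD_lie actZ_lie Uh_actDl act_Z.
  by rewrite pairD actD_lie actZ_lie.
have -> : u = (u.1, 0) + (u.2 : K) *: ebd2 q.
  case: u => x b; congr pair => /=; first by rewrite scaler0 addr0.
  by rewrite add0r -[b *: 1]/(b * 1) mulr1.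
rewrite !actD_lie !actZ_lie Uh_actDl act_Z eqvB Omega_d2.
by rewrite -Uh_actA act_X1.
Qed.

End Transfer.

Theorem theorem3p4 (R : realType) (q : R[i]) (q_neq0 : q != 0)
    (M : lieModType (eblock q)) :
  Uh_free_of_rank M 1%N ->
  exists (l1 l2 alpha : R[i]) (l1_neq0 : l1 != 0) (l2_neq0 : l2 != 0),
    lie_isomorphic M (Omega q alpha l1_neq0 l2_neq0).
Proof. exact: rank1_Omega. Qed.
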